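(* Let $A$ and $B$ be polynomially compact operators on a complex Hilbert space $\mathcal H$. Suppose that $A$ is normal and that $A[A,B]=0$. Then $A$ and $B$ are simultaneously triangularizable and $[A,B]^2=0$. If $B$ is also normal, then $A$ and $B$ are simultaneously diagonalizable, and so they commute.
   Context: Operators on $\mathcal H$ are bounded linear operators $\mathcal H\to\mathcal H$, and $[A,B]=AB-BA$. An operator $T$ is polynomially compact if there is a nonzero complex polynomial $p$ such that $p(T)$ is compact. $A$ and $B$ are simultaneously triangularizable if there is a chain (a set totally ordered by inclusion) of closed subspaces of $\mathcal H$, each invariant under both $A$ and $B$, which is maximal as a chain in the lattice of all closed subspaces of $\mathcal H$. An operator is diagonalizable if its eigenvectors span $\mathcal H$ (i.e. have closed linear span $\mathcal H$); $A$ and $B$ are simultaneously diagonalizable if their common eigenvectors span $\mathcal H$ in this sense. *)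

(* Defs.v *)
From mathcomp Require Import all_boot all_order all_algebra.
From mathcomp Require Export sesquilinear complex.
From mathcomp Require Import all_classical all_reals all_analysis.
Import Order.TTheory GRing.Theory Num.Theory.
Import numFieldNormedType.Exports.

Set Implicit Arguments.
Unset Strict Implicit.
Unset Printing Implicit Defensive.

Local Open Scope classical_set_scope.
Local Open Scope ring_scope.
Local Open Scope complex_scope.

Section Operators.
Variables (R : realType) (H : completeNormedModType R[i]).

(* A complex Hilbert space is a complete normed space whose norm comes from an
   inner product; dot is linear in its first argument and conjugate-linear in
   the second, and the norm takes (real) values in R[i]. *)
Definition is_hilbert (dot : {dot H for Num.conj}) : Prop :=
  forall x, dot x x = `|x| ^+ 2.

Definition bounded_operator (T : {linear H -> H}) : Prop :=
  exists M : R[i], forall x, `|T x| <= M * `|x|.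

Definition commutator (S T : H -> H) : H -> H :=
  fun x => S (T x) - T (S x).

Definition poly_op (p : {poly R[i]}) (T : H -> H) : H -> H :=
  fun x => \sum_(i < size p) p`_i *: iter i T x.

Definition compact_operator (T : H -> H) : Prop :=
  precompact (T @` [set x | `|x| <= 1]).

Definition polynomially_compact (T : H -> H) : Prop :=
  exists p : {poly R[i]}, p != 0 /\ compact_operator (poly_op p T).

Definition is_adjoint (dot : {dot H for Num.conj}) (T T' : H -> H) : Prop :=
  forall x y, dot (T x) y = dot x (T' y).

(* The adjoint of a bounded operator exists and is unique, so the existential
   only names it. *)
Definition normal_operator (dot : {dot H for Num.conj}) (T : {linear H -> H}) :
    Prop :=
  exists T' : {linear H -> H},
    [/\ bounded_operator T', is_adjoint dot T T' &
        forall x, T (T' x) = T' (T x)].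

Definition subspace (M : set H) : Prop :=
  M 0 /\ forall (a : R[i]) x y, M x -> M y -> M (a *: x + y).

Definition closed_subspace (M : set H) : Prop := subspace M /\ closed M.

Definition invariant_under (T : H -> H) (M : set H) : Prop := T @` M `<=` M.

Definition subspace_chain (C : set (set H)) : Prop :=
  C `<=` closed_subspace /\ total_on C subset.

Definition maximal_subspace_chain (C : set (set H)) : Prop :=
  subspace_chain C /\
  forall D : set (set H), subspace_chain D -> C `<=` D -> D = C.

Definition simultaneously_triangularizable (S T : H -> H) : Prop :=
  exists C : set (set H), maximal_subspace_chain C /\
    forall M, C M -> invariant_under S M /\ invariant_under T M.

Definition closed_span (X : set H) : set H := closure (smallest subspace X).

Definition eigenvector (T : H -> H) (x : H) : Prop :=
  x != 0 /\ exists a : R[i], T x = a *: x.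

Definition simultaneously_diagonalizable (S T : H -> H) : Prop :=
  closed_span [set x | eigenvector S x /\ eigenvector T x] = setT.

End Operators.

(* Main.v *)
Require Import Defs.
From mathcomp Require Import all_boot all_order all_algebra.
From mathcomp Require Import all_classical all_reals all_analysis.
From mathcomp Require Import ring lra.
From mathcomp Require separable cyclotomic cyclic.
From HB Require Import structures.
Import Order.TTheory GRing.Theory Num.Theory.
Import numFieldNormedType.Exports.
Local Open Scope classical_set_scope.
Local Open Scope ring_scope.
Local Open Scope complex_scope.

(**
  Why the theorem holds.

  Normality of A gives ker A^2 = ker A.  Together with A[A,B] = 0 this makes
  ker A invariant under B (kernel_invariant_of_left_annihilated).  The range of
  [A,B] lies in ker A, and [A,B] vanishes on ker A, so [A,B]^2 = 0.

  Triangularization.  Take by Zorn a maximal chain C among the chains of closed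
  subspaces invariant under A and B.  If C is not maximal among all chains of
  closed subspaces, some closed N sits strictly between the closed span M- of the
  members of C below it and the intersection M+ of the members above it
  (maximal_chain_of_no_gap).  A jointly invariant closed subspace strictly
  between M- and M+ contradicts the maximality of C; invariant_between provides
  one.  The closure of M- + (M+ meet ker A) is invariant and does the job unless
  it is M- or M+, and in both of these cases [A,B] maps M+ into M-.  Then the
  compressions of A and B to E, the orthogonal complement of M- in M+, commute and
  are polynomially compact.  If both are scalar, the intersection of N with E serves.
  Otherwise one of them, say T, is not scalar, and a subspace of E that is
  invariant under everything commuting with T is needed.

  That is a theorem of Lomonosov
  (polynomially_compact_hyperinvariant).  Let K = q(T) be compact with q not
  constant.  An eigenvalue of K different from 0, or a nonzero vector killed by
  K, yields an eigenvector of T, because T satisfies a polynomial equation at some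
  nonzero vector; the eigenspace is then the required subspace.  Otherwise the
  argument of Hilden applies
  (decaying_compact_hyperinvariant): it needs only that K is compact, nonzero on
  E, and that r^n |K^n| falls below 1 for some n, for each r > 0.

  The last property is the spectral radius formula for compact K without nonzero
  eigenvalues, proved without complex function theory (eigenvalue_or_power_decay).
  By compactness 1 - zK is bounded below uniformly for |z| <= r.  The average of
  the resolvents (1 - w^k t K)^-1 over the n-th roots of unity w^k is
  (1 - t^n K^n)^-1.  The resolvents being Lipschitz in t with a constant that
  does not depend on n, smallness of t^n K^n propagates from t = 0 to t = r in
  finitely many steps of fixed length (power_decay_step).

  Both operators normal.  If E is nonzero, closed and invariant under A and B,
  then A and B have a common eigenvector in E (common_eigenvector): either
  ker A meets E, and B acts on ker A meet E, or [A,B] vanishes on E, and B acts on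
  an eigenspace of A in E.  The existence of eigenvectors for a normal polynomially
  compact operator on an invariant subspace (normal_eigenvector) uses the same
  dichotomy: the powers of a normal operator at a vector grow at least
  geometrically, which is incompatible with decay.  Applied to the orthogonal
  complement of the common eigenvectors, this shows that they span.  Commutation
  holds on eigenvectors, hence on their closed span.
*)

Set Implicit Arguments.
Unset Strict Implicit.
Unset Printing Implicit Defensive.

(* The same name also denotes the subspace topology. *)
Local Notation subspace := Defs.subspace.

(** * Real-valued norms *)

Lemma ltr0c (R : realType) (r : R) : (0 < r%:C) = (0 < r).
Proof. by rewrite -(ltcR 0 r). Qed.

(** The norm of a complex normed space takes values in R[i], where the order is
    only partial; its real part lives in R, where inequalities are decided
    by linear arithmetic. *)
Definition nm (R : realType) (V : normedZmodType R[i]) (x : V) : R :=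
  complex.Re `|x|.

Section RealNorm.
Variables (R : realType) (V : normedZmodType R[i]).
Implicit Types x y : V.

Lemma normE x : `|x| = (nm x)%:C.
Proof. by rewrite RRe_real // normr_real. Qed.

Lemma nm_ge0 x : 0 <= nm x.
Proof. by rewrite -ler0c -normE. Qed.

Lemma nm_eq0 x : (nm x == 0) = (x == 0).
Proof. by rewrite -[RHS]normr_eq0 normE eq_complex /= eqxx andbT. Qed.

Lemma nm0 : nm (0 : V) = 0.
Proof. by apply/eqP; rewrite nm_eq0. Qed.

Lemma nm_gt0 x : (0 < nm x) = (x != 0).
Proof. by rewrite lt_def nm_ge0 andbT nm_eq0. Qed.

Lemma nm_le0 x : nm x <= 0 -> x = 0.
Proof. by move=> h; apply/eqP; rewrite -nm_eq0 eq_le h nm_ge0. Qed.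

Lemma nmD x y : nm (x + y) <= nm x + nm y.
Proof. by rewrite -lecR rmorphD /= -!normE ler_normD. Qed.

Lemma nmN x : nm (- x) = nm x.
Proof. by rewrite /nm normrN. Qed.

Lemma nmC x y : nm (x - y) = nm (y - x).
Proof. by rewrite /nm distrC. Qed.

Lemma nmB x y : nm (x - y) <= nm x + nm y.
Proof. by rewrite -(nmN y) nmD. Qed.

Lemma nm_dist x y z : nm (x - z) <= nm (x - y) + nm (y - z).
Proof. by rewrite -{1}[x](subrK y) -addrA nmD. Qed.

Lemma nm_revD x y : nm x - nm y <= nm (x - y).
Proof. by rewrite lerBlDr (le_trans _ (nmD _ _)) // subrK. Qed.

Lemma nm_sum (I : Type) (s : seq I) (P : pred I) (F : I -> V) :
  nm (\sum_(i <- s | P i) F i) <= \sum_(i <- s | P i) nm (F i).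
Proof.
elim/big_rec2: _ => [|i y z _ h]; first by rewrite nm0.
by rewrite (le_trans (nmD _ _)) // lerD2l.
Qed.

End RealNorm.

Section RealNormScalar.
Variables (R : realType).
Implicit Types a b : R[i].

Lemma nm_scalarM a b : nm (a * b) = nm a * nm b.
Proof. by apply: complexI; rewrite rmorphM /= -!normE normrM. Qed.

Lemma nm_scalarX a n : nm (a ^+ n) = nm a ^+ n.
Proof. by apply: complexI; rewrite rmorphXn /= -!normE normrX. Qed.

Lemma nm1 : nm (1 : R[i]) = 1.
Proof. by rewrite /nm normr1. Qed.

Lemma nm_real (r : R) : nm r%:C = `|r|.
Proof. by apply: complexI; rewrite -normE normc_def /= expr0n addr0 sqrtr_sqr. Qed.

Lemma nmZ (V : normedModType R[i]) a (x : V) : nm (a *: x) = nm a * nm x.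
Proof. by apply: complexI; rewrite rmorphM /= -!normE normrZ. Qed.

End RealNormScalar.

(** * Closedness, completeness and compactness in terms of norms *)

Section MetricInterface.
Variables (R : realType) (V : normedModType R[i]).
Implicit Types (x y : V) (M : set V).

Lemma nbhs_nmP x (P : set V) :
  nbhs x P <-> exists2 e : R, 0 < e & forall y, nm (x - y) < e -> P y.
Proof.
rewrite nbhs_ballP; split=> [[e /= e0 eP]|[e e0 eP]].
- have eE : e = (complex.Re e)%:C by rewrite RRe_real // gtr0_real.
  exists (complex.Re e); first by rewrite -ltr0c -eE.
  by move=> y xy; apply: eP; rewrite -ball_normE /= eE normE ltcR.
- exists e%:C; first by rewrite /= ltr0c.
  by move=> y; rewrite -ball_normE /= normE ltcR; apply: eP.
Qed.

Lemma closure_nmP M x :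
  closure M x <-> forall e : R, 0 < e -> exists2 y, M y & nm (x - y) < e.
Proof.
split=> [Mx e e0|h B /nbhs_nmP[e e0 eB]].
- have /Mx[y [My xy]] : nbhs x [set y | nm (x - y) < e].
    by apply/nbhs_nmP; exists e.
  by exists y.
- by have [y My xy] := h e e0; exists y; split=> //; apply: eB.
Qed.

Lemma closed_nmP M :
  closed M <->
  forall x, (forall e : R, 0 < e -> exists2 y, M y & nm (x - y) < e) -> M x.
Proof.
split=> [cM x /closure_nmP/cM //|h x /closure_nmP]; exact: h.
Qed.

Lemma compact_seq_cluster (M : set V) (u : nat -> V) :
  precompact M -> (forall n, M (u n)) ->
  exists y, forall e : R, 0 < e -> forall N, exists2 n, (N <= n)%N & nm (y - u n) < e.
Proof.
move=> [C MC [cC _]] uM.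
have uC : (u @ \oo) C by exists 0%N => // n _; apply: MC.
have [y [_ yu]] := cC (u @ \oo) _ uC.
exists y => e e0 N.
have uN : (u @ \oo) [set u n | n in [set n | (N <= n)%N]].
  by exists N => // n /= Nn; exists n.
have ye : nbhs y [set z | nm (y - z) < e] by apply/nbhs_nmP; exists e.
by have [_ [[n /= Nn <-] yn]] := yu _ _ uN ye; exists n.
Qed.

End MetricInterface.

Lemma nm_complete (R : realType) (V : completeNormedModType R[i])
    (u : nat -> V) :
  (forall e : R, 0 < e -> exists N, forall m n,
      (N <= m)%N -> (N <= n)%N -> nm (u m - u n) < e) ->
  exists l, forall e : R, 0 < e -> exists N, forall n, (N <= n)%N ->
      nm (l - u n) < e.
Proof.
move=> cu.
have : cauchy (u @ \oo).
  apply/cauchy_ballP => e e0.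
  have eE : e = (complex.Re e)%:C by rewrite RRe_real // gtr0_real.
  have [|N hN] := cu (complex.Re e); first by rewrite -ltr0c -eE.
  exists (u @` [set n | (N <= n)%N], u @` [set n | (N <= n)%N]).
    by split; exists N => // n /= Nn; exists n.
  move=> [_ _] [/= [m Nm <-] [n Nn <-]] /=.
  by rewrite -ball_normE /= eE normE ltcR; apply: hN.
move=> /cauchy_cvg /cvg_ex [l ul]; exists l => e e0.
have /ul[N _ hN] : nbhs l [set z | nm (l - z) < e] by apply/nbhs_nmP; exists e.
by exists N => n Nn; apply: hN.
Qed.

Section CompactOperators.
Variables (R : realType) (H : completeNormedModType R[i]).
Implicit Types (x y : H) (K : {linear H -> H}).

Definition bounded_by (c : R) (T : H -> H) := forall x, nm (T x) <= c * nm x.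

Lemma bounded_operatorP (T : {linear H -> H}) :
  bounded_operator T -> exists2 c : R, 0 < c & bounded_by c T.
Proof.
move=> [M hM]; exists (`|complex.Re M| + 1); first by rewrite ltr_wpDl.
move=> x; have := hM x; rewrite !normE.
have [->|x0] := eqVneq x 0; first by rewrite linear0 nm0 mulr0.
have xp : 0 < nm x by rewrite nm_gt0.
case: M {hM} => a b; simpc => /andP[_ h]; apply: (le_trans h).
by rewrite ler_pM2r // (le_trans (ler_norm _)) // lerDl.
Qed.

Lemma bounded_byW (T : {linear H -> H}) c : bounded_by c T -> bounded_operator T.
Proof.
by move=> h; exists c%:C => x; rewrite !normE -rmorphM /= lecR.
Qed.

(** The form in which compactness is used in the spectral arguments.  A requirement [Q e]
    that tightens as [e] decreases and can be met for every [e] by a vector of the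
    ball of radius [r] is met by vectors whose images under the compact operator
    [K] accumulate at one point [y]. *)
Lemma compact_extract K (Q : R -> H -> Prop) (r : R) :
  compact_operator K ->
  (forall e d x, e <= d -> Q e x -> Q d x) ->
  (forall e, 0 < e -> exists2 x, nm x <= r & Q e x) ->
  exists y, forall e, 0 < e -> exists x, [/\ nm x <= r, Q e x & nm (y - K x) < e].
Proof.
move=> cK Qm hQ.
have r0 : 0 <= r by have [x xr _] := hQ 1 ltr01; apply: le_trans xr; apply: nm_ge0.
(* Rescaling to the unit ball; [r + 1] is positive even when [r = 0]. *)
pose s := r + 1; have s0 : 0 < s by rewrite ltr_wpDl.
pose sc : R[i] := (s^-1)%:C.
have e0 n : 0 < n.+1%:R^-1 :> R by rewrite invr_gt0 ltr0n.
pose u n := projT1 (cid2 (hQ _ (e0 n))).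
have uP n : nm (u n) <= r /\ Q n.+1%:R^-1 (u n).
  by rewrite /u; case: cid2.
have [n|y hy] := @compact_seq_cluster _ _ _ (fun n => K (sc *: u n)) cK.
  exists (sc *: u n) => //=; rewrite normE nmZ nm_real ger0_norm ?invr_ge0 ?(ltW s0) //.
  rewrite -(rmorph1 (real_complex R)) lecR mulrC ler_pdivrMr // mul1r.
  by rewrite (le_trans (uP n).1) // lerDl.
exists (s%:C *: y) => e ep.
have es : 0 < e / s by rewrite divr_gt0.
have [N hN] : exists N : nat, e^-1 < N.+1%:R.
  by exists (Num.bound e^-1); rewrite (lt_trans (archi_boundP _)) ?ltr_nat // invr_ge0 ltW.
have [n Nn hn] := hy _ es N.
exists (u n); split; first exact: (uP n).1.
  apply: Qm (uP n).2; rewrite -[leRHS]invrK lef_pV2 ?posrE ?invr_gt0 ?ltr0n //.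
  by rewrite (le_trans (ltW hN)) // ler_nat.
have -> : K (u n) = s%:C *: K (sc *: u n).
  by rewrite linearZ scalerA -rmorphM /= divff ?gt_eqF // scale1r.
rewrite -scalerBr nmZ nm_real gtr0_norm // mulrC -ltr_pdivlMr //.
Qed.

End CompactOperators.

(** * Closed subspaces and orthogonal projections *)

Section Subspaces.
Variables (R : realType) (H : completeNormedModType R[i]).
Implicit Types (x y : H) (M N X : set H) (T : {linear H -> H}).

Lemma subspaceZ M a x : subspace M -> M x -> M (a *: x).
Proof. by move=> [M0 h] Mx; rewrite -[_ *: _]addr0; apply: h. Qed.

Lemma subspaceD M x y : subspace M -> M x -> M y -> M (x + y).
Proof. by move=> [M0 h] Mx My; rewrite -(scale1r x); apply: h. Qed.

Lemma subspaceB M x y : subspace M -> M x -> M y -> M (x - y).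
Proof.
by move=> sM Mx My; apply: subspaceD => //; rewrite -scaleN1r; apply: subspaceZ.
Qed.

Lemma subspace_preimage T M : subspace M -> subspace (T @^-1` M).
Proof.
move=> [M0 h]; split=> [|a x y] /=; first by rewrite linear0.
by rewrite linearP; apply: h.
Qed.

Lemma closed_preimage T M c : bounded_by c T -> closed M -> closed (T @^-1` M).
Proof.
move=> Tc /closed_nmP cM; apply/closed_nmP => x hx /=; apply: cM => e e0.
have c0 : 0 < `|c| + 1 by rewrite ltr_wpDl.
have [y /= My xy] := hx (e / (`|c| + 1)) (divr_gt0 e0 c0).
exists (T y) => //; rewrite -linearB; apply: le_lt_trans (Tc _) _.
apply: (@le_lt_trans _ _ ((`|c| + 1) * nm (x - y))).
  by rewrite ler_wpM2r ?nm_ge0 // (le_trans (ler_norm _)) // lerDl.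
by rewrite mulrC -ltr_pdivlMr.
Qed.

Lemma closed_subspace_preimage T M :
  bounded_operator T -> closed_subspace M -> closed_subspace (T @^-1` M).
Proof.
move=> /bounded_operatorP[c _ Tc] [sM cM]; split; first exact: subspace_preimage.
exact: closed_preimage Tc cM.
Qed.

Lemma closed_subspaceI M N :
  closed_subspace M -> closed_subspace N -> closed_subspace (M `&` N).
Proof.
move=> [[M0 sM] cM] [[N0 sN] cN]; split; last exact: closedI.
by split=> // a x y [Mx Nx] [My Ny]; split; [apply: sM|apply: sN].
Qed.

Lemma closed_subspace_bigcap (I : Type) (D : set I) (F : I -> set H) :
  (forall i, D i -> closed_subspace (F i)) ->
  closed_subspace (\bigcap_(i in D) F i).
Proof.
move=> h; split; last by apply: closed_bigI => i /h[].
split=> [i /h[[]]//|a x y hx hy i Di].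
by have [[_ s] _] := h i Di; apply: s; [apply: hx|apply: hy].
Qed.

Lemma subspace_closure M : subspace M -> closed_subspace (closure M).
Proof.
move=> sM; split; last exact: closed_closure.
split; first by apply: subset_closure; case: sM.
move=> a x y /closure_nmP hx /closure_nmP hy; apply/closure_nmP => e e0.
have a0 : 0 < nm a + 1 by rewrite ltr_wpDl ?nm_ge0.
have e2 : 0 < e / 2 by rewrite divr_gt0.
have [x' Mx xx] := hx (e / 2 / (nm a + 1)) (divr_gt0 e2 a0).
have [y' My yy] := hy (e / 2) e2.
exists (a *: x' + y'); first by case: sM => _; apply.
rewrite opprD addrACA -scalerBr (le_lt_trans (nmD _ _)) // nmZ.
rewrite [e]splitr ltr_leD // ?(ltW yy) //.
apply: (@le_lt_trans _ _ ((nm a + 1) * nm (x - x'))).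
  by rewrite ler_wpM2r ?nm_ge0 // lerDl.
by rewrite mulrC -ltr_pdivlMr.
Qed.

Lemma closure_invariant T M :
  bounded_operator T -> invariant_under T M -> invariant_under T (closure M).
Proof.
move=> /bounded_operatorP[c _ Tc] inv _ [x Mx <-].
apply: (closed_preimage Tc (@closed_closure _ M)).
by apply: closureS Mx; move=> y My; apply: subset_closure; apply: inv; exists y.
Qed.

Lemma closed_span_subspace X : closed_subspace (closed_span X).
Proof.
apply: subspace_closure; split=> [M [[]]//|a x y hx hy M MX].
by have [[_ s] _] := MX; apply: s; [apply: hx|apply: hy].
Qed.

Lemma sub_closed_span X : X `<=` closed_span X.
Proof. by move=> x Xx; apply: subset_closure => M [_]; apply. Qed.

Lemma closed_span_min X M : closed_subspace M -> X `<=` M -> closed_span X `<=` M.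
Proof.
move=> [sM cM] XM x; rewrite [M](closure_id _).1 //.
by apply: closureS => y; apply.
Qed.

Lemma closed_span_invariant T X :
  bounded_operator T -> invariant_under T X -> invariant_under T (closed_span X).
Proof.
move=> bT inv _ [x Xx <-].
apply: (closed_span_min (closed_subspace_preimage bT (closed_span_subspace X)) _ Xx).
by move=> y Xy; apply: sub_closed_span; apply: inv; exists y.
Qed.

Lemma closed_subspace0 : closed_subspace [set 0 : H].
Proof.
split; first by split=> // a x y -> ->; rewrite scaler0 addr0.
apply/closed_nmP => x h; apply: nm_le0; apply/ler_addgt0Pl => e e0.
by have [_ -> /ltW] := h e e0; rewrite subr0 addr0.
Qed.

End Subspaces.

Section InnerProduct.
Variables (R : realType) (H : completeNormedModType R[i]).
Variables (dot : {dot H for Num.conj}) (H_hilbert : is_hilbert dot).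
Implicit Types (x y z : H) (M : set H) (a : R[i]).

Lemma dotDl x y z : dot (x + y) z = dot x z + dot y z.
Proof. exact: linearDl. Qed.

Lemma dotZl a x z : dot (a *: x) z = a * dot x z.
Proof. exact: linearZl_LR. Qed.

Lemma dotNl x z : dot (- x) z = - dot x z.
Proof. by rewrite -scaleN1r dotZl mulN1r. Qed.

Lemma dotBl x y z : dot (x - y) z = dot x z - dot y z.
Proof. by rewrite dotDl dotNl. Qed.

Lemma dot0l z : dot 0 z = 0.
Proof. by rewrite -(scale0r 0) dotZl mul0r. Qed.

Lemma dotC x y : dot x y = (dot y x)^*%R.
Proof. by rewrite hermC expr0 mul1r. Qed.

Lemma dotDr x y z : dot z (x + y) = dot z x + dot z y.
Proof. by rewrite dotC dotDl rmorphD /= -!dotC. Qed.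

Lemma dotZr a x z : dot z (a *: x) = a^*%R * dot z x.
Proof. by rewrite dotC dotZl rmorphM /= -dotC. Qed.

Lemma dotBr x y z : dot z (x - y) = dot z x - dot z y.
Proof. by rewrite dotC dotBl rmorphB /= -!dotC. Qed.

Lemma dot0r z : dot z 0 = 0.
Proof. by rewrite dotC dot0l rmorph0. Qed.

Lemma dot_eq0C x y : dot x y = 0 -> dot y x = 0.
Proof. by move=> h; rewrite dotC h rmorph0. Qed.

Lemma dotxx x : dot x x = (nm x ^+ 2)%:C.
Proof. by rewrite H_hilbert normE rmorphXn. Qed.

Lemma dotxx_eq0 x : dot x x = 0 -> x = 0.
Proof.
rewrite dotxx => /complexI/eqP; rewrite expf_eq0 /= => /eqP h.
by apply: nm_le0; rewrite h.
Qed.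

Lemma pythagoras x y : dot x y = 0 -> nm (x + y) ^+ 2 = nm x ^+ 2 + nm y ^+ 2.
Proof.
move=> h; apply: complexI; rewrite -dotxx dotDl !dotDr h (dot_eq0C h).
by rewrite addr0 add0r !dotxx -rmorphD.
Qed.

Lemma parallelogram x y :
  nm (x + y) ^+ 2 + nm (x - y) ^+ 2 = 2 * nm x ^+ 2 + 2 * nm y ^+ 2.
Proof.
have E (r : R) : (2 * r)%:C = 2 * r%:C by rewrite rmorphM /= rmorph_nat.
apply: complexI; rewrite !rmorphD /= !E -!dotxx.
rewrite !(dotBl, dotDl) !(dotBr, dotDr); ring.
Qed.

Lemma dot_reject x y : y != 0 -> dot (x - (dot x y / dot y y) *: y) y = 0.
Proof.
move=> y0; rewrite dotBl dotZl divfK ?subrr //.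
by apply: contra_neq y0; exact: dotxx_eq0.
Qed.

Lemma nm_dot_reject x y (a := dot x y / dot y y) : y != 0 ->
  nm x ^+ 2 = nm (x - a *: y) ^+ 2 + (nm a * nm y) ^+ 2.
Proof.
move=> y0; rewrite -nmZ -pythagoras ?subrK //.
by rewrite dotZr dot_reject // mulr0.
Qed.

Lemma cauchy_schwarz x y : nm (dot x y) <= nm x * nm y.
Proof.
have [->|y0] := eqVneq y 0; first by rewrite dot0r !nm0 mulr0.
have yp : 0 < nm y by rewrite nm_gt0.
have -> : dot x y = (dot x y / dot y y) * dot y y.
  by rewrite divfK //; apply: contra_neq y0; exact: dotxx_eq0.
rewrite nm_scalarM {2}dotxx nm_real ger0_norm ?sqr_ge0 // expr2 mulrA.
rewrite ler_pM2r // -(@ler_pXn2r _ 2) ?nnegrE ?mulr_ge0 ?nm_ge0 //.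
by rewrite (nm_dot_reject x y0) lerDr sqr_ge0.
Qed.

(** A minimizing sequence for the distance from [x] to [M] is Cauchy by the
    parallelogram law; its limit [m] is a nearest point, and subtracting from
    [x - m] its component along some [y] of [M] could only shorten it, so
    that component is zero. *)
Lemma orth_component M x : closed_subspace M ->
  exists2 m, M m & forall y, M y -> dot (x - m) y = 0.
Proof.
move=> [sM /closed_nmP cM].
pose D := [set nm (x - y) | y in M].
have hD : has_inf D.
  split; first by exists (nm (x - 0)), 0 => //; case: sM.
  by exists 0 => _ [y _ <-]; apply: nm_ge0.
pose d := inf D.
have dle y : M y -> d <= nm (x - y).
  by move=> My; apply: ge_inf; [case: hD|exists y].
have d0 : 0 <= d by apply: lb_le_inf; [case: hD|move=> _ [y _ <-]; apply: nm_ge0].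
have near_d e : 0 < e -> exists2 y, M y & nm (x - y) < d + e.
  by move=> e0; have [_ [y My <-] h] := inf_adherent e0 hD; exists y.
have close e : 0 < e -> exists2 r, 0 < r & forall y z, M y -> M z ->
    nm (x - y) < d + r -> nm (x - z) < d + r -> nm (y - z) < e.
  (* With [|x - y|, |x - z| < d + r] and the midpoint at distance at least [d],
     the parallelogram law gives [|y - z| ^ 2 < 8 d r + 4 r ^ 2]. *)
  move=> e0; pose r := Num.min 1 (e ^+ 2 / (8 * d + 5)).
  have dp : 0 < 8 * d + 5 by lra.
  have r0 : 0 < r by rewrite lt_min ltr01 divr_gt0 ?exprn_gt0.
  have r1 : r <= 1 by rewrite ge_min lexx.
  have rd : r * (8 * d + 5) <= e ^+ 2 by rewrite -ler_pdivlMr // ge_min lexx orbT.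
  exists r => // y z My Mz xy xz.
  have := parallelogram (x - y) (x - z).
  have -> : x - y - (x - z) = z - y by rewrite opprB addrC subrKA.
  have -> : x - y + (x - z) = 2%:R *: (x - 2%:R^-1 *: (y + z)).
    by rewrite scalerBr scalerA divff ?pnatr_eq0 // scale1r scaler_nat mulr2n addrACA -opprD.
  have n2 : nm (2%:R : R[i]) = 2 by rewrite -(rmorph_nat (real_complex R)) nm_real normr_nat.
  rewrite nmZ n2 (nmC z).
  have /dle m : M (2%:R^-1 *: (y + z)) by apply: subspaceZ => //; apply: subspaceD.
  set p := nm _ in m *; set q := nm (y - z).
  have hy := nm_ge0 (x - y); have hz := nm_ge0 (x - z); have q0 := nm_ge0 (y - z).
  move=> E; rewrite -(@ltr_pXn2r _ 2) ?nnegrE ?(ltW e0) //.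
  nra.
have e0 n : 0 < n.+1%:R^-1 :> R by rewrite invr_gt0 ltr0n.
pose u n := projT1 (cid2 (near_d _ (e0 n))).
have [uM ud] : (forall n, M (u n)) /\ forall n, nm (x - u n) < d + n.+1%:R^-1.
  by split=> n; rewrite /u; case: cid2.
have small r : 0 < r -> exists N : nat, forall n, (N <= n)%N -> nm (x - u n) < d + r.
  move=> r0; exists (Num.bound r^-1) => n Nn; apply: lt_le_trans (ud n) _.
  rewrite lerD2l -[leRHS]invrK lef_pV2 ?posrE ?invr_gt0 ?ltr0n //.
  rewrite ltW // (lt_le_trans (archi_boundP _)) ?invr_ge0 ?(ltW r0) // ler_nat.
  exact: leqW.
have [|m um] := @nm_complete _ _ u.
  move=> e e1; have [r r0 hr] := close e e1; have [N hN] := small r r0.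
  by exists N => i j Ni Nj; apply: hr => //; apply: hN.
have Mm : M m.
  by apply: cM => e /um[N hN]; exists (u N) => //; apply: hN.
have xm : nm (x - m) <= d.
  apply/ler_addgt0Pl => e e1.
  have [N1 h1] := small _ (divr_gt0 e1 (ltr0n _ 2)).
  have [N2 h2] := um _ (divr_gt0 e1 (ltr0n _ 2)).
  have := h1 _ (leq_maxl N1 N2); have := h2 _ (leq_maxr N1 N2).
  have := nm_dist x (u (maxn N1 N2)) m; rewrite (nmC m); lra.
exists m => // y My; have [->|y0] := eqVneq y 0; first by rewrite dot0r.
have := nm_dot_reject (x - m) y0.
set a := _ / _; have : d <= nm (x - m - a *: y).
  by rewrite -addrA -opprD; apply: dle; apply: subspaceD => //; apply: subspaceZ.
have -> : dot (x - m) y = a * dot y y.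
  by rewrite divfK //; apply: contra_neq y0; exact: dotxx_eq0.
move=> h1 h2; have {h2} : nm a * nm y <= 0.
  have := mulr_ge0 (nm_ge0 a) (nm_ge0 y); have := nm_ge0 (x - m).
  set s := nm a * nm y in h2 *; move: h1 h2 xm d0; nra.
rewrite -nmZ => /nm_le0/eqP; rewrite scaler_eq0 (negPf y0) orbF => /eqP ->.
by rewrite mul0r.
Qed.

Definition orth M : set H := [set x | forall y, M y -> dot x y = 0].

Lemma orth_closed_subspace M : closed_subspace (orth M).
Proof.
split; first split=> [y _|a x y hx hy z Mz] /=; first by rewrite dot0l.
  by rewrite dotDl dotZl hx // hy // mulr0 addr0.
apply/closed_nmP => x h y My; apply/eqP; rewrite -nm_eq0 eq_le nm_ge0 andbT.
apply/ler_addgt0Pl => e e0; rewrite addr0.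
have y0 : 0 < nm y + 1 by rewrite ltr_wpDl ?nm_ge0.
have [z hz xz] := h _ (divr_gt0 e0 y0).
rewrite -[dot x y]subr0 -(hz y My) -dotBl (le_trans (cauchy_schwarz _ _)) //.
apply: (@le_trans _ _ (nm (x - z) * (nm y + 1))).
  by rewrite ler_wpM2l ?nm_ge0 // lerDl.
by rewrite -ler_pdivlMr // ltW.
Qed.

Lemma orth_neq0 M : closed_subspace M -> M != setT ->
  exists2 x, x != 0 & orth M x.
Proof.
move=> cM /eqP MT; have [x Mx] : exists x, ~ M x.
  apply: contrapT => h; apply: MT; apply/seteqP; split=> // x _.
  by apply: contrapT => Mx; apply: h; exists x.
have [m Mm hm] := orth_component x cM; exists (x - m) => //.
by apply: contra_notN Mx; rewrite subr_eq0 => /eqP ->.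
Qed.

Lemma projection M : closed_subspace M ->
  exists P : {linear H -> H}, [/\ forall x, M (P x), forall x, M x -> P x = x,
    forall x, orth M (x - P x) & bounded_by 1 P].
Proof.
move=> cM; have [sM _] := cM.
pose P x := projT1 (cid2 (orth_component x cM)).
have PM x : M (P x) by rewrite /P; case: cid2.
have PO x : orth M (x - P x) by rewrite /P; case: cid2.
have P_unique x m : M m -> orth M (x - m) -> P x = m.
  move=> Mm Om; apply/eqP; rewrite -subr_eq0; apply/eqP; apply: dotxx_eq0.
  have Md : M (P x - m) by apply: subspaceB.
  have {1}-> : P x - m = (x - m) - (x - P x) by rewrite opprB [RHS]addrC subrKA.
  by rewrite dotBl Om // PO // subrr.
have Plin : linear P.
  move=> a x y; apply: P_unique; first by case: sM => _; apply.
  rewrite opprD addrACA -scalerBr.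
  by have [[_ s] _] := orth_closed_subspace M; apply: s.
pose P' : {linear H -> H} := HB.pack P (GRing.isLinear.Build _ _ _ _ P Plin).
exists P'; split=> //= x.
  move=> Mx; apply: P_unique => //; rewrite subrr.
  by have [[]] := orth_closed_subspace M.
rewrite mul1r -(@ler_pXn2r _ 2) ?nnegrE ?nm_ge0 //.
have := pythagoras (PO x (P x) (PM x)); rewrite subrK => ->.
by rewrite lerDr sqr_ge0.
Qed.

End InnerProduct.

(** * Polynomials in an operator, normal operators *)

Section PolynomialsOfOperators.
Variables (R : realType) (H : completeNormedModType R[i]).
Implicit Types (x y : H) (p q r : {poly R[i]}) (M F : set H).

Lemma poly_op_widen n p (T : H -> H) x : (size p <= n)%N ->
  poly_op p T x = \sum_(i < n) p`_i *: iter i T x.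
Proof.
move=> pn; rewrite /poly_op (big_ord_widen _ (fun i => p`_i *: iter i T x) pn).
rewrite big_mkcond /=; apply: eq_bigr => i _; case: ltnP => // h.
by rewrite nth_default // scale0r.
Qed.

Lemma poly_opD p q (T : H -> H) x :
  poly_op (p + q) T x = poly_op p T x + poly_op q T x.
Proof.
pose n := maxn (size p) (size q).
rewrite (@poly_op_widen n (p + q)) ?size_polyD // (@poly_op_widen n p) ?leq_maxl //.
rewrite (@poly_op_widen n q) ?leq_maxr // -big_split; apply: eq_bigr => i _ /=.
by rewrite coefD scalerDl.
Qed.

Lemma poly_opZ c p (T : H -> H) x : poly_op (c *: p) T x = c *: poly_op p T x.
Proof.
rewrite (@poly_op_widen (size p) (c *: p)) ?size_scale_leq // scaler_sumr.
by apply: eq_bigr => i _; rewrite coefZ scalerA.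
Qed.

Lemma poly_opC c (T : H -> H) x : poly_op c%:P T x = c *: x.
Proof.
by rewrite (@poly_op_widen 1) ?size_polyC_leq1 // big_ord1 coefC.
Qed.

Lemma iter_linear n (T : {linear H -> H}) : linear (iter n T).
Proof.
by elim: n => [|n IH] a x y //=; rewrite IH linearP.
Qed.

Lemma poly_op_is_linear p (T : {linear H -> H}) : linear (poly_op p T).
Proof.
move=> a x y; rewrite /poly_op scaler_sumr -big_split; apply: eq_bigr => i _ /=.
by rewrite iter_linear scalerDr !scalerA mulrC.
Qed.

HB.instance Definition _ p (T : {linear H -> H}) :=
  GRing.isLinear.Build _ _ _ _ (poly_op p T) (@poly_op_is_linear p T).

Lemma iter_invariant n (T : H -> H) M x :
  invariant_under T M -> M x -> M (iter n T x).
Proof. by move=> inv Mx; elim: n => //= n IH; apply: inv; exists (iter n T x). Qed.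

Lemma subspace_sum (I : Type) (s : seq I) (f : I -> H) M :
  subspace M -> (forall i, M (f i)) -> M (\sum_(i <- s) f i).
Proof.
move=> sM Mf; elim/big_rec: _ => [|i x _ Mx]; first by case: sM.
exact: subspaceD.
Qed.

Lemma poly_op_invariant p (T : H -> H) M :
  subspace M -> invariant_under T M -> invariant_under (poly_op p T) M.
Proof.
move=> sM inv _ [x Mx <-]; apply: subspace_sum => // i.
by apply: subspaceZ => //; apply: iter_invariant.
Qed.

(** With [A = B] this is about commutation; with [S] a projection it compares
    a polynomial of an operator with the polynomial of its compression. *)
Lemma poly_op_intertwine p (S : {linear H -> H}) (A B : H -> H) M x :
  invariant_under A M -> (forall y, M y -> S (A y) = B (S y)) -> M x ->
  S (poly_op p A x) = poly_op p B (S x).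
Proof.
move=> inv SAB Mx; rewrite /poly_op linear_sum; apply: eq_bigr => i _.
rewrite linearZ; congr (_ *: _); elim: (val i) => //= n IH.
by rewrite SAB ?IH //; apply: iter_invariant.
Qed.

Lemma poly_op_mulX p (T : {linear H -> H}) x :
  poly_op (p * 'X) T x = T (poly_op p T x).
Proof.
rewrite (@poly_op_widen (size p).+1); last first.
  by rewrite (leq_trans (size_polyMleq _ _)) // size_polyX addn2.
rewrite big_ord_recl coefMX /= scale0r add0r linear_sum; apply: eq_bigr => i _.
by rewrite coefMX /= linearZ.
Qed.

Lemma poly_op_mulXsubC p a (T : {linear H -> H}) x :
  poly_op (p * ('X - a%:P)) T x = T (poly_op p T x) - a *: poly_op p T x.
Proof.
rewrite mulrBr [p * a%:P]mulrC mul_polyC -[- _]scaleN1r poly_opD !poly_opZ.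
by rewrite poly_op_mulX scaleN1r.
Qed.

Lemma poly_opXsubC a (T : {linear H -> H}) x :
  poly_op ('X - a%:P) T x = T x - a *: x.
Proof. by rewrite -[_ - _]mul1r poly_op_mulXsubC -polyC1 poly_opC scale1r. Qed.

(** Divide [p] by a linear factor as long as the quotient still kills [x]: the
    last nonzero vector obtained is an eigenvector. *)
Lemma annihilated_eigenvector p (T : {linear H -> H}) M x :
  subspace M -> invariant_under T M -> M x -> x != 0 ->
  p != 0 -> poly_op p T x = 0 -> exists2 y, M y & eigenvector T y.
Proof.
move=> sM inv Mx x0; have [n] := ubnP (size p).
elim: n p => // n IH p; rewrite ltnS => pn p0 px.
have [p1|/closed_rootP[a /factor_theorem[r pE]]] := eqVneq (size p) 1%N.
  move/eqP/size_poly1P: p1 => [c c0 pE]; move: px; rewrite pE poly_opC => /eqP.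
  by rewrite scaler_eq0 (negPf c0) (negPf x0).
have r0 : r != 0 by apply: contra_neq p0 => r0; rewrite pE r0 mul0r.
have [rx|rx] := eqVneq (poly_op r T x) 0.
  apply: IH rx => //; apply: leq_trans pn.
  by rewrite pE size_Mmonic ?monicXsubC // size_XsubC addn2.
exists (poly_op r T x); first by apply: (poly_op_invariant sM inv); exists x.
split=> //; exists a; apply/eqP; rewrite -subr_eq0 -poly_op_mulXsubC -pE; exact/eqP.
Qed.

Lemma bounded_operator_id : bounded_operator (idfun : {linear H -> H}).
Proof. by exists 1 => x; rewrite mul1r. Qed.

Lemma bounded_operator_comp (S T : {linear H -> H}) :
  bounded_operator S -> bounded_operator T -> bounded_operator (S \o T).
Proof.
move=> /bounded_operatorP[c c0 Sc] /bounded_operatorP[d _ Td].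
apply: (@bounded_byW _ _ (S \o T) (c * d)) => x /=.
by rewrite (le_trans (Sc _)) // -mulrA ler_pM2l// ; exact: Td.
Qed.

Lemma bounded_by_iter n c (T : H -> H) :
  0 <= c -> bounded_by c T -> bounded_by (c ^+ n) (iter n T).
Proof.
move=> c0 Tc; elim: n => [|n IH] x /=; first by rewrite mul1r.
by rewrite (le_trans (Tc _)) // exprS -mulrA ler_wpM2l //; exact: IH.
Qed.

Lemma poly_op_bounded p (T : {linear H -> H}) :
  bounded_operator T -> bounded_operator (poly_op p T).
Proof.
move=> /bounded_operatorP[c c0 Tc].
apply: (@bounded_byW _ _ _ (\sum_(i < size p) nm p`_i * c ^+ i)) => x.
rewrite (le_trans (nm_sum _ _ _)) // mulr_suml ler_sum // => i _.
by rewrite nmZ -mulrA ler_wpM2l ?nm_ge0 //; apply: bounded_by_iter => //; apply: ltW.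
Qed.

End PolynomialsOfOperators.

Section NormalOperators.
Variables (R : realType) (H : completeNormedModType R[i]).
Variables (dot : {dot H for Num.conj}) (H_hilbert : is_hilbert dot).
Implicit Types (T : {linear H -> H}) (x y : H).

Lemma is_adjoint_sym T T' : is_adjoint dot T T' -> is_adjoint dot T' T.
Proof. by move=> h x y; rewrite dotC -h -dotC. Qed.

Lemma nm_adjoint T T' x : is_adjoint dot T T' ->
  (forall x, T (T' x) = T' (T x)) -> nm (T' x) = nm (T x).
Proof.
move=> adj comm; apply/eqP; rewrite -(@eqrXn2 _ 2) ?nm_ge0 //; apply/eqP.
apply: complexI; rewrite -!(dotxx H_hilbert).
by rewrite -adj comm (is_adjoint_sym adj).
Qed.

Lemma adjoint_iter n T (T' : H -> H) :
  is_adjoint dot T T' -> is_adjoint dot (iter n T) (iter n T').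
Proof.
move=> adj; elim: n => [|n IH] x y //; rewrite iterS adj IH.
by rewrite -iterSr.
Qed.

Lemma poly_op_adjoint p T T' : is_adjoint dot T T' ->
  is_adjoint dot (poly_op p T) (poly_op (map_poly Num.conj p) T').
Proof.
move=> adj x y; rewrite (@poly_op_widen _ _ (size p) (map_poly _ _)) ?size_map_poly //.
rewrite /poly_op; elim/big_rec2: _ => [|i u v _ IH]; first by rewrite dot0l dot0r.
rewrite dotDl dotDr dotZl dotZr IH coef_map /= conjCK; congr (_ * _ + _).
exact: adjoint_iter.
Qed.

Lemma poly_op_normal p T : normal_operator dot T -> normal_operator dot (poly_op p T).
Proof.
move=> [T' [bT' adj comm]]; exists (poly_op (map_poly Num.conj p) T').
split; first exact: poly_op_bounded.
  exact: poly_op_adjoint.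
move=> x; apply: (@poly_op_intertwine _ _ _ (poly_op p T) T' T' setT) => // y _.
by apply/esym; apply: (@poly_op_intertwine _ _ _ T' T T setT).
Qed.

(** By Cauchy-Schwarz, since [|T x| ^ 2 = <T* T x, x>] and, for normal [T],
    [|T* (T x)| = |T (T x)|]. *)
Lemma normal_log_convex T x : normal_operator dot T ->
  nm (T x) ^+ 2 <= nm (T (T x)) * nm x.
Proof.
move=> [T' [_ adj comm]].
have := cauchy_schwarz H_hilbert (T' (T x)) x.
rewrite (nm_adjoint _ adj comm); apply: le_trans.
rewrite (is_adjoint_sym adj) dotxx //.
by rewrite nm_real ger0_norm ?sqr_ge0.
Qed.

Lemma normal_ker2 T x : normal_operator dot T -> T (T x) = 0 -> T x = 0.
Proof.
move=> /normal_log_convex h Tx; apply: nm_le0.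
have := h x; rewrite Tx nm0 mul0r -[X in _ <= X](expr0n _ 2%N) => h2.
by have := nm_ge0 (T x); nra.
Qed.

(** An eigenvector of a normal operator is an eigenvector of the adjoint, because
    [T - a] is normal and hence has the kernel of its adjoint; so its orthogonal
    complement is invariant. *)
Lemma normal_orth_eigen T x a y : normal_operator dot T ->
  T x = a *: x -> dot y x = 0 -> dot (T y) x = 0.
Proof.
move=> /(poly_op_normal ('X - a%:P))[K' [_ adj comm]] Tx yx.
have /nm_le0 K'x : nm (K' x) <= 0.
  by rewrite (nm_adjoint _ adj comm) /= poly_opXsubC Tx subrr nm0.
have := adj y x; rewrite K'x dot0r /= poly_opXsubC dotBl dotZl yx mulr0 => /eqP.
by rewrite subr0 => /eqP.
Qed.

End NormalOperators.

(** * Decay of powers without complex function theory *)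

Lemma nm_iter_pow (R : realType) (H : completeNormedModType R[i])
    (T : H -> H) (s q : R) n j : 0 <= s -> 0 <= q ->
  (forall x, s ^+ n * nm (iter n T x) <= q * nm x) ->
  forall x, s ^+ (j * n) * nm (iter (j * n) T x) <= q ^+ j * nm x.
Proof.
move=> s0 q0 h; elim: j => [|j IH] x; first by rewrite !mul1r.
rewrite mulSn iterD exprD -mulrA mulrCA.
apply: le_trans (ler_wpM2l (exprn_ge0 _ s0) (h _)) _.
by rewrite mulrCA exprS -mulrA ler_wpM2l.
Qed.

Lemma geometric_small (R : realType) (C e : R) : 0 < e ->
  exists N : nat, forall n, (N <= n)%N -> C * (4^-1) ^+ n < e.
Proof.
move=> e0; exists (Num.bound (`|C| / e)) => n Nn.
have h : `|C| < e * n%:R.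
  rewrite mulrC -ltr_pdivrMr // (lt_le_trans (archi_boundP _)) ?ler_nat //.
  by rewrite divr_ge0 // ltW.
have n4 : n%:R <= (4 : R) ^+ n by rewrite -natrX ler_nat ltnW // ltn_expl.
have p4 : 0 < (4 : R) ^+ n by rewrite exprn_gt0.
rewrite exprVn ltr_pdivrMr //; apply: le_lt_trans (ler_norm _) _.
by apply: lt_le_trans h _; rewrite ler_pM2l.
Qed.

(** The partial sums [u n] of the Neumann series of [T] applied to [x] converge
    to the solution; the factor 1/4 is the one met in [power_decay_step]. *)
Lemma neumann_solve (R : realType) (H : completeNormedModType R[i])
    (T : H -> H) :
  {morph T : x y / x - y} -> (forall y, nm (T y) <= 4^-1 * nm y) ->
  forall x, exists y, y - T y = x.
Proof.
move=> TB T4 x.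
pose u := fix u n := if n is n'.+1 then x + T (u n') else 0.
have T0 : T 0 = 0 by apply: nm_le0; have := T4 0; rewrite nm0 mulr0.
have u2 m : nm (u m) <= 2 * nm x.
  elim: m => [|m IH] /=; first by rewrite nm0 mulr_ge0 ?nm_ge0.
  by have := nmD x (T (u m)); have := T4 (u m); have := nm_ge0 x; lra.
have uC n m : nm (u (n + m)%N - u n) <= (2 * nm x) * (4^-1) ^+ n.
  elim: n => [|n IH]; first by rewrite add0n subr0 mulr1.
  rewrite addSn /= opprD addrACA subrr add0r -TB (le_trans (T4 _)) // exprS mulrCA.
  by rewrite ler_pM2l.
have [|y hy] := @nm_complete _ _ u.
  move=> e e0; have [N hN] := geometric_small (4 * nm x) e0.
  exists N => m n Nm Nn.
  have E a : (N <= a)%N -> nm (u a - u N) <= (2 * nm x) * (4^-1) ^+ N.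
    by move=> Na; rewrite -(subnKC Na).
  have := hN N (leqnn _); have := E _ Nm; have := E _ Nn.
  by have := nm_dist (u m) (u N) (u n); rewrite (nmC (u N)); lra.
exists y; apply/eqP; rewrite -subr_eq0; apply/eqP; apply: nm_le0.
apply/ler_addgt0Pl => e e0; rewrite addr0.
have [N hN] := hy (e / 2) (divr_gt0 e0 (ltr0n _ 2)).
have := hN _ (leqnn N); have := hN _ (leqnSn N) => /=.
have -> : y - T y - x = (y - (x + T (u N))) - T (y - u N).
  by rewrite TB opprB opprD !addrA subrK addrAC.
have := nmB (y - (x + T (u N))) (T (y - u N)); have := T4 (y - u N).
by have := nm_ge0 (y - u N); lra.
Qed.

Section Resolvent.
Variables (R : realType) (H : completeNormedModType R[i]).
Implicit Types (K : {linear H -> H}) (x y : H) (z : R[i]).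

(** The truncation at order [n] of the power series of [(1 - z K)^-1 y].  It is
    the exact value of [(1 - z K)^-1] at [y - z^n K^n y], a vector that is the same
    for all [z = w^k t] with [w^n = 1]: the identities that involve resolvents
    become identities between finite sums, and [1 - z K] need not be inverted. *)
Definition partial_resolvent z n K y := \sum_(j < n) z ^+ j *: iter j K y.

Lemma partial_resolventE z n K y :
  partial_resolvent z n K y - z *: K (partial_resolvent z n K y) =
  y - z ^+ n *: iter n K y.
Proof.
rewrite /partial_resolvent; elim: n => [|n IH].
  by rewrite big_ord0 linear0 scaler0 subr0 scale1r subrr.
rewrite big_ord_recr /= linearD scalerDr opprD addrACA IH [K _]linearZ /= scalerA.
by rewrite -exprS addrA subrK.
Qed.

Lemma root_of_unity_sum (n : nat) : (0 < n)%N -> exists w : R[i],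
  [/\ nm w = 1, w ^+ n = 1 &
      forall j, (0 < j < n)%N -> \sum_(k < n) (w ^+ k) ^+ j = 0].
Proof.
move=> n0; pose p : {poly R[i]} := 'X^n - 1.
have [r] := closed_field_poly_normal p.
rewrite (monicP _) ?monicXnsubC // scale1r => pE.
have rn : all n.-unity_root r.
  by apply/allP => z zr; rewrite /root_of_unity -/p pE root_prod_XsubC.
have sr : (n <= size r)%N by rewrite -ltnS -(size_prod_XsubC r id) -pE size_XnsubC.
have ur : uniq r.
  by rewrite -separable.separable_prod_XsubC -pE
             cyclotomic.separable_Xn_sub_1 // pnatr_eq0 -lt0n.
have /hasP[w _ pw] := cyclic.has_prim_root n0 rn ur sr.
have wn := prim_expr_order pw; exists w; split=> //.
  apply/eqP; rewrite -(@eqrXn2 _ n) ?nm_ge0 // -nm_scalarX wn nm1 expr1n //.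
move=> j /andP[j0 jn]; apply/eqP.
have : (w ^+ j - 1) * (\sum_(k < n) (w ^+ k) ^+ j) == 0.
  under eq_bigr do rewrite exprAC.
  by rewrite -subrX1 exprAC wn expr1n subrr.
rewrite mulf_eq0 subr_eq0 => /orP[|//].
by rewrite -(prim_order_dvd pw) gtnNdvd.
Qed.

(** Averaging over the [n]-th roots of unity leaves the constant term only. *)
Lemma partial_resolvent_average w (s : R[i]) n K y : (0 < n)%N ->
  (forall j, (0 < j < n)%N -> \sum_(k < n) (w ^+ k) ^+ j = 0) ->
  \sum_(k < n) partial_resolvent (w ^+ k * s) n K y = n%:R *: y.
Proof.
case: n => // n _ h; rewrite /partial_resolvent exchange_big big_ord_recl /=.
rewrite [X in _ + X]big1 => [|j _].
  rewrite addr0 (eq_bigr (fun=> y)) => [|k _]; last by rewrite expr0 scale1r.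
  by rewrite sumr_const card_ord scaler_nat.
under eq_bigr do rewrite exprMn -scalerA.
by rewrite -scaler_suml h ?scale0r //= /bump /= add1n ltnS.
Qed.

(** A bound for the spectral radius of [K] by [1 / s] in disguise.  Any constant
    below 1 would express the same property; 3/4 leaves room for the losses in
    [power_decay_step]. *)
Definition power_decay (K : H -> H) (s : R) :=
  exists2 n, (0 < n)%N & forall x, s ^+ n * nm (iter n K x) <= 3 / 4 * nm x.

Variables (K : {linear H -> H}) (k d r : R).
Hypotheses (k0 : 0 < k) (d0 : 0 < d).
Hypothesis K_bounded : bounded_by k K.
Hypothesis K_below : forall z y, nm z <= r -> d * nm y <= nm (y - z *: K y).

(** Given [y'], put [x = y' - t^n K^n y'] and let [y] solve [y - s^n K^n y = x].
    Then [y'] and [y] are the averages over the roots of unity [w^j] of the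
    vectors [v j] and [u j], which solve [(1 - w^j t K) (v j) = x] and
    [(1 - w^j s K) (u j) = x].  As [1 - z K] is bounded below by [d] on the disc,
    [v j] and [u j] differ by at most [(t - s) k / d ^ 2] times [|x|], whatever
    [n] is.  So [y'] is close to [y], which is close to [x] because [s^n K^n] is
    small; hence [y' - x = t^n K^n y'] is small compared with [y']. *)
Lemma power_decay_step s t : 0 <= s -> s <= t -> t <= r ->
  (t - s) * k <= d ^+ 2 / 12 -> power_decay K s -> power_decay K t.
Proof.
move=> s0 st tr small [m m0 hm]; have t0 := le_trans s0 st.
(* Taking fifth powers replaces 3/4 by [(3/4) ^ 5 < 1/4]. *)
pose n := (5 * m)%N; have n0 : (0 < n)%N by rewrite muln_gt0.
have hn x : s ^+ n * nm (iter n K x) <= 4^-1 * nm x.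
  apply: le_trans (@nm_iter_pow _ _ K s (3 / 4) m 5 s0 _ hm x) _; first by lra.
  by rewrite ler_wpM2r ?nm_ge0 //; lra.
have [w [w1 wn ws]] := root_of_unity_sum n0.
exists n => // y'.
pose x := y' - t%:C ^+ n *: iter n K y'.
have real_pow (a : R) v : 0 <= a -> nm (a%:C ^+ n *: iter n K v) = a ^+ n * nm (iter n K v).
  by move=> a0; rewrite nmZ nm_scalarX nm_real ger0_norm.
have [] := @neumann_solve _ _ (fun y => s%:C ^+ n *: iter n K y) _ _ x.
- move=> a b /=; rewrite -scalerBr; congr (_ *: _).
  by rewrite [a - b]addrC -(scaleN1r b) iter_linear scaleN1r [RHS]addrC.
- by move=> y; rewrite real_pow.
move=> y yx.
pose v (j : 'I_n) := partial_resolvent (w ^+ j * t%:C) n K y'.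
pose u (j : 'I_n) := partial_resolvent (w ^+ j * s%:C) n K y.
have wj (j : 'I_n) : (w ^+ j) ^+ n = 1 by rewrite exprAC wn expr1n.
have wj1 (j : 'I_n) : nm (w ^+ j) = 1 by rewrite nm_scalarX w1 expr1n.
have vE j : v j - (w ^+ j * t%:C) *: K (v j) = x.
  by rewrite partial_resolventE exprMn wj mul1r.
have uE j : u j - (w ^+ j * s%:C) *: K (u j) = x.
  by rewrite partial_resolventE exprMn wj mul1r.
have close j : nm (v j - u j) <= nm x / 12.
  have hu : d * nm (u j) <= nm x.
    by rewrite -(uE j) K_below // nm_scalarM wj1 mul1r nm_real ger0_norm // (le_trans st).
  have : d * nm (v j - u j) <= nm ((w ^+ j * (t - s)%:C) *: K (u j)).
    have -> : (w ^+ j * (t - s)%:C) *: K (u j) =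
              v j - u j - (w ^+ j * t%:C) *: K (v j - u j).
      rewrite linearB scalerBr.
      have -> (a b e f : H) : a - b - (e - f) = (a - e) - (b - f).
        by rewrite !opprB addrACA [RHS]addrACA [- b - e]addrC.
      by rewrite vE -(uE j) opprB [RHS]addrC subrKA -scalerBl -mulrBr -rmorphB.
    by rewrite K_below // nm_scalarM wj1 mul1r nm_real ger0_norm.
  rewrite nmZ nm_scalarM wj1 mul1r nm_real ger0_norm ?subr_ge0 //.
  have := K_bounded (u j); have := nm_ge0 (u j); have := nm_ge0 (K (u j)).
  move=> Ku0 u0 Kuk h.
  have : d * nm (v j - u j) <= (d ^+ 2 / 12) * nm (u j).
    apply: le_trans h _; apply: (@le_trans _ _ ((t - s) * (k * nm (u j)))).
      by rewrite ler_wpM2l ?subr_ge0.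
    by rewrite mulrA ler_wpM2r.
  rewrite expr2 -!mulrA ler_pM2l // => h2; apply: le_trans h2 _.
  lra.
have yy : nm (y' - y) <= nm x / 12.
  have n0R : 0 < n%:R :> R by rewrite ltr0n.
  rewrite -(ler_pM2l n0R) -{1}(normr_nat R n) -nm_real rmorph_nat -nmZ scalerBr.
  rewrite -(partial_resolvent_average t%:C K y' n0 ws).
  rewrite -(partial_resolvent_average s%:C K y n0 ws) -sumrB.
  rewrite (le_trans (nm_sum _ _ _)) // (le_trans (ler_sum _ (fun j _ => close j))) //.
  by rewrite sumr_const card_ord mulr_natl.
have yxn : nm (y - x) <= 4^-1 * nm y by rewrite -yx subKr real_pow.
have y'x : nm (y' - x) = t ^+ n * nm (iter n K y') by rewrite subKr real_pow.
rewrite -y'x.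
(* [|y - x| <= |x| / 3] and [|y' - y| <= |x| / 12] give [|y' - x| <= 5/12 |x|],
   whence [|y' - x| <= 5/7 |y'|]. *)
have := nm_dist y' y x; have := nm_revD y x; have := nm_revD x y'; rewrite (nmC x).
have := nm_ge0 x; lra.
Qed.

(** Half of the spectral radius formula: start from the trivial decay at radius 0
    and make steps of the length that [power_decay_step] allows. *)
Lemma power_decay_of_bounded_below : 0 <= r -> power_decay K r.
Proof.
move=> r0; have d12 : 0 < d ^+ 2 / 12 by rewrite divr_gt0 // exprn_gt0.
pose m := (Num.bound (r * k / (d ^+ 2 / 12))).+1.
have m0 : 0 < m%:R :> R by rewrite ltr0n.
have step : r / m%:R * k <= d ^+ 2 / 12.
  rewrite mulrAC ler_pdivrMr // [leRHS]mulrC -ler_pdivrMr // ltW //.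
  apply: lt_le_trans (archi_boundP _) _; first by rewrite divr_ge0 ?mulr_ge0 // ltW.
  by rewrite ler_nat leqW.
have decay j : (j <= m)%N -> power_decay K (j%:R * (r / m%:R)).
  elim: j => [_|j IH jm].
    by exists 1%N => // x; rewrite mul0r expr1 mul0r mulr_ge0 ?nm_ge0 //; lra.
  have rm : 0 <= r / m%:R by rewrite divr_ge0 // ltW.
  apply: (power_decay_step _ _ _ _ (IH (ltnW jm))).
  - by rewrite mulr_ge0.
  - by rewrite ler_wpM2r // ler_nat.
  - rewrite mulrA ler_pdivrMr // mulrC ler_wpM2l // ler_nat //.
  - by rewrite -mulrBl -natrB // subSnn mul1r.
by have := decay m (leqnn _); rewrite mulrC divfK // gt_eqF.
Qed.

End Resolvent.

(** * Hyperinvariant subspaces *)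

Section CompactLemmas.
Variables (R : realType) (H : completeNormedModType R[i]).
Implicit Types (S T P K : {linear H -> H}) (x y : H).

Lemma bounded_continuous S : bounded_operator S -> continuous S.
Proof.
move=> /bounded_operatorP[c c0 Sc] x A /nbhs_nmP[e e0 eA].
apply/nbhs_nmP; exists (e / c); first by rewrite divr_gt0.
move=> y xy; apply: eA; rewrite -linearB (le_lt_trans (Sc _)) //.
by rewrite mulrC -ltr_pdivlMr.
Qed.

Lemma compact_operator_sandwich S K P : bounded_operator S -> bounded_operator P ->
  compact_operator K -> compact_operator (S \o K \o P).
Proof.
move=> bS /bounded_operatorP[c c0 Pc] [C KC [cC _]].
pose S' : {linear H -> H} := c%:C \*: S.
have bS' : bounded_operator S'.
  have [s s0 Ss] := bounded_operatorP bS.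
  apply: (@bounded_byW _ _ _ (c * s)) => x /=.
  by rewrite nmZ nm_real gtr0_norm // -mulrA ler_pM2l //; exact: Ss.
have cSC : compact (S' @` C).
  by apply: continuous_compact => //; apply: continuous_subspaceT; exact: bounded_continuous.
exists (S' @` C); last by split=> //; apply: compact_closed => //; exact: norm_hausdorff.
move=> _ [x x1 <-]; exists (K (c^-1%:C *: P x)).
  apply: KC; exists (c^-1%:C *: P x) => //=; move: x1 => /=.
  rewrite !normE -(rmorph1 (real_complex R)) !lecR => x1.
  rewrite nmZ nm_real gtr0_norm ?invr_gt0 // mulrC ler_pdivrMr // mul1r.
  by rewrite (le_trans (Pc _)) // ger_pMr.
by rewrite /= [K (_ *: _)]linearZ [S (_ *: _)]linearZ /= scalerA -rmorphM /=
           divff ?gt_eqF // scale1r.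
Qed.

End CompactLemmas.

Section Hyperinvariant.
Variables (R : realType) (H : completeNormedModType R[i]).
Variables (dot : {dot H for Num.conj}) (H_hilbert : is_hilbert dot).
Implicit Types (S T P K : {linear H -> H}) (x y : H) (E L : set H).

Lemma best_approximation x y z : y != 0 ->
  nm (x - (dot x y / dot y y) *: y) <= nm (x - z *: y).
Proof.
move=> y0; rewrite -(@ler_pXn2r _ 2) ?nnegrE ?nm_ge0 //.
rewrite (nm_dot_reject H_hilbert (x - z *: y) y0).
have yy : dot y y != 0 by apply: contra_neq y0; exact: dotxx_eq0.
by rewrite dotBl dotZl mulrBl mulfK // scalerBl opprB addrC addrA subrK addrC lerDl sqr_ge0.
Qed.

(** If the lower bound failed, there would be unit vectors [x] and scalars [z] in
    the disc with [x] close to [z *: K x], and [K x] close to a fixed [y].  Then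
    [y] is nonzero and close to [z *: K y].  The scalar [z] depends on the degree
    of approximation; rather than extracting a limit of the [z]'s, one takes the
    projection of [y] on the line of [K y], which is nearer still. *)
Lemma compact_bounded_below K r : bounded_operator K -> compact_operator K ->
  (forall a x, a != 0 -> x != 0 -> K x <> a *: x) -> 0 <= r ->
  exists2 d, 0 < d & forall z y, nm z <= r -> d * nm y <= nm (y - z *: K y).
Proof.
move=> /bounded_operatorP[k k0 Kk] cK noeig r0.
apply: contrapT => h.
pose Q e x := nm x = 1 /\ exists2 z, nm z <= r & nm (x - z *: K x) < e.
have [e d x ed [x1 [z zr xz]]|e e0|y hy] := @compact_extract _ _ K Q 1 cK.
- by split=> //; exists z => //; apply: lt_le_trans ed.
- apply: contrapT => h1; apply: h; exists e => // z y zr.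
  rewrite leNgt; apply/negP => lt; apply: h1.
  have y0 : 0 < nm y.
    rewrite lt_neqAle nm_ge0 andbT; apply/negP => /eqP y0.
    by move: lt; rewrite -y0 mulr0 ltNge nm_ge0.
  pose x := (nm y)^-1%:C *: y.
  have x1 : nm x = 1.
    by rewrite nmZ nm_real gtr0_norm ?invr_gt0 // mulVf // gt_eqF.
  exists x; first by rewrite x1.
  split=> //; exists z => //.
  rewrite [K (_ *: _)]linearZ /= scalerA mulrC -scalerA -scalerBr nmZ nm_real.
  by rewrite gtr0_norm ?invr_gt0 // mulrC ltr_pdivrMr.
have y0 : y != 0.
  apply/eqP => y0; have e0 : 0 < (2 * (1 + r))^-1 by rewrite invr_gt0; lra.
  have [x [_ [x1 [z zr xz]] yK]] := hy _ e0.
  move: yK xz; rewrite y0 sub0r nmN => yK xz.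
  have := nm_revD x (z *: K x); rewrite x1 nmZ => h1.
  have h2 : nm z * nm (K x) <= r * (2 * (1 + r))^-1.
    by apply: ler_pM => //; rewrite ?nm_ge0 // ltW.
  have : (1 + r) * (2 * (1 + r))^-1 = 2^-1.
    by rewrite invfM mulrCA divff ?mulr1 //; lra.
  set s := _^-1 in e0 yK xz h2 *; lra.
have near e : 0 < e -> exists2 z, nm z <= r & nm (y - z *: K y) < e.
  move=> e0; pose c := 1 + k + r * k.
  have c0 : 0 < c by have := mulr_ge0 r0 (ltW k0); rewrite /c; lra.
  have ec : 0 < e / c by rewrite divr_gt0.
  have [x [_ [x1 [z zr xz]] yK]] := hy _ ec.
  exists z => //.
  have -> : y - z *: K y = (y - K x) + (K (x - z *: K x) + z *: K (K x - y)).
    rewrite !linearB [K (z *: _)]linearZ /= [X in _ = _ + X]addrA subrK.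
    by rewrite addrA subrK.
  have h1 := le_trans (Kk _) (ler_wpM2l (ltW k0) (ltW xz)).
  have h2 : nm z * nm (K (K x - y)) <= r * (k * (e / c)).
    apply: ler_pM; rewrite ?nm_ge0 // (le_trans (Kk _)) // nmC.
    by apply: ler_wpM2l; apply: ltW.
  have ecc : e / c * c = e by rewrite divfK // gt_eqF.
  have h3 t : t * c = t + k * t + r * (k * t) by rewrite /c; ring.
  rewrite h3 in ecc.
  have := nmD (y - K x) (K (x - z *: K x) + z *: K (K x - y)).
  have := nmD (K (x - z *: K x)) (z *: K (K x - y)).
  rewrite nmZ; lra.
have Ky0 : K y != 0.
  apply/eqP => Ky0; move: y0; rewrite -nm_gt0 => /near[z _].
  by rewrite Ky0 scaler0 subr0 ltxx.
pose a := dot y (K y) / dot (K y) (K y).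
have ya : y = a *: K y.
  apply/eqP; rewrite -subr_eq0; apply/eqP; apply: nm_le0.
  apply/ler_addgt0Pl => e /near[z _ /ltW yz]; rewrite addr0.
  exact: le_trans (best_approximation _ _ Ky0) yz.
have a0 : a != 0 by apply: contra_neq y0 => a0; rewrite ya a0 scale0r.
apply: (noeig a^-1 y); rewrite ?invr_eq0 //.
by rewrite {2}ya scalerA mulVf // scale1r.
Qed.

(** What replaces the Fredholm alternative and the spectral radius formula in the
    rest of the proof. *)
Lemma eigenvalue_or_power_decay K : bounded_operator K -> compact_operator K ->
  (exists a x, [/\ a != 0, x != 0 & K x = a *: x]) \/
  (forall r, 0 <= r -> power_decay K r).
Proof.
move=> bK cK; have [h|h] := pselect (exists a x, [/\ a != 0, x != 0 & K x = a *: x]).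
  by left.
right=> r r0; have [k k0 Kk] := bounded_operatorP bK.
have [|d d0 hd] := compact_bounded_below bK cK _ r0.
  by move=> a x a0 x0 Kx; apply: h; exists a, x.
exact: power_decay_of_bounded_below k0 d0 Kk hd r0.
Qed.

(** Operators on the closed subspace [E] are represented by operators on the whole
    space that preserve [E]; only their restrictions matter. *)
Definition commutant_on E T S :=
  [/\ bounded_operator S, invariant_under S E & forall x, E x -> S (T x) = T (S x)].

Lemma commutant_on_comp E T S1 S2 :
  commutant_on E T S1 -> commutant_on E T S2 -> commutant_on E T (S1 \o S2).
Proof.
move=> [b1 i1 c1] [b2 i2 c2]; split; first exact: bounded_operator_comp.
  by move=> _ [x Ex <-] /=; apply: i1; exists (S2 x) => //; apply: i2; exists x.
by move=> x Ex /=; rewrite c2 // c1 //; apply: i2; exists x.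
Qed.

Lemma commutant_on_lin E T a S1 S2 : subspace E ->
  commutant_on E T S1 -> commutant_on E T S2 ->
  commutant_on E T ((a \*: S1) \+ S2).
Proof.
move=> sE [b1 i1 c1] [b2 i2 c2]; split.
- have [k1 _ h1] := bounded_operatorP b1; have [k2 _ h2] := bounded_operatorP b2.
  apply: (@bounded_byW _ _ _ (nm a * k1 + k2)) => x /=.
  rewrite (le_trans (nmD _ _)) // nmZ mulrDl -mulrA.
  by apply: lerD (h2 x); apply: ler_wpM2l (h1 x); exact: nm_ge0.
- move=> _ [x Ex <-] /=; apply: sE.2; first by apply: i1; exists x.
  by apply: i2; exists x.
- by move=> x Ex /=; rewrite c1 // c2 // linearP.
Qed.

Lemma commutant_on_id E T : commutant_on E T idfun.
Proof.
by split=> //; [exact: bounded_operator_id|move=> _ [x Ex <-]].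
Qed.

Definition nontrivial_in L E :=
  [/\ closed_subspace L, L `<=` E, exists2 x, L x & x != 0 & exists2 x, E x & ~ L x].

(** Hilden's argument.  If no such subspace exists, every nonzero vector of [E] is
    cyclic for the commutant.  Let [x0] be so long that the image under [K] of the
    ball [D] of radius 1 around [x0] stays away from 0.  By compactness of [K],
    some bound [c] is such that each [K x] with [x] in [D] is sent back to [D] by
    a member of the commutant bounded by [c].  Starting from [x0] and alternating
    [n] times, one gets a point of [D] of the form [S (K^n x0)] with [|S| <= c^n],
    of norm at most [c^n |K^n x0|].  For some [n] this is at most [3/4 |x0|], while
    all points of [D] are longer. *)
Lemma decaying_compact_hyperinvariant E K x1 : closed_subspace E ->
  bounded_operator K -> compact_operator K -> invariant_under K E ->
  E x1 -> K x1 != 0 -> (forall r, 0 <= r -> power_decay K r) ->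
  exists2 L, nontrivial_in L E &
    forall S, commutant_on E K S -> invariant_under S L.
Proof.
move=> [sE cE] bK cK KE Ex1 Kx1 decay; apply: contrapT => noL.
have dense y : E y -> y != 0 -> forall x e, E x -> 0 < e ->
    exists2 S, commutant_on E K S & nm (x - S y) < e.
  move=> Ey y0 x e Ex e0.
  pose M := [set z | exists2 S, commutant_on E K S & z = S y].
  have sM : subspace M.
    have clos a z1 z2 : M z1 -> M z2 -> M (a *: z1 + z2).
      move=> [S1 c1 ->] [S2 c2 ->]; exists ((a \*: S1) \+ S2) => //.
      exact: commutant_on_lin.
    have My : M y by exists idfun => //; exact: commutant_on_id.
    by split=> //; rewrite -(subrr y) addrC -scaleN1r; apply: clos.
  have ME : closure M `<=` E.
    rewrite [E](closure_id _).1 //; apply: closureS => _ [S [_ i _] ->].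
    by apply: i; exists y.
  have /closure_nmP/(_ _ e0)[_ [S cS ->] xS] : closure M x.
    apply: contrapT => Mx; apply: noL; exists (closure M); last first.
      move=> S cS; apply: closure_invariant; first by case: cS.
      by move=> _ [_ [S' cS' ->] <-]; exists (S \o S') => //; apply: commutant_on_comp.
    split=> //; first exact: subspace_closure.
      by exists y => //; apply: subset_closure; exists idfun => //; exact: commutant_on_id.
    by exists x.
  by exists S.
have [k k0 Kk] := bounded_operatorP bK.
have x1p : 0 < nm x1.
  by rewrite nm_gt0; apply: contra_neq Kx1 => ->; rewrite linear0.
have Kx1p : 0 < nm (K x1) by rewrite nm_gt0.
(* Both summands matter: [x0] is longer than 4 and [K x0] longer than [k]. *)
pose s := 5 / nm x1 + (k + 1) / nm (K x1); pose x0 := s%:C *: x1.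
have s0 : 0 < s by rewrite addr_gt0 // divr_gt0 // addr_gt0.
have x04 : 4 < nm x0.
  rewrite nmZ nm_real gtr0_norm // mulrDl divfK ?gt_eqF //.
  have : 0 <= (k + 1) / nm (K x1) * nm x1.
    by rewrite mulr_ge0 ?nm_ge0 // divr_ge0 ?nm_ge0 // addr_ge0 // ltW.
  lra.
have Kx0 : k + 1 <= nm (K x0).
  rewrite linearZ nmZ nm_real gtr0_norm // mulrDl divfK ?gt_eqF //.
  by rewrite lerDr mulr_ge0 // ?divr_ge0 // ?ltW.
have Ex0 : E x0 by apply: subspaceZ.
pose good c x := exists S, [/\ commutant_on E K S, bounded_by c S & nm (S (K x) - x0) <= 1].
(* Failure of [good (1 / e)] is a requirement that tightens as [e] decreases. *)
have [c c0 hc] : exists2 c, 0 < c & forall x, E x -> nm (x - x0) <= 1 -> good c x.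
  apply: contrapT => h.
  pose Q e x := [/\ 0 < e, E x, nm (x - x0) <= 1 & ~ good e^-1 x].
  have [e d x ed [e0 Ex xx0 bad]|e e0|y hy] := @compact_extract _ _ K Q (nm x0 + 1) cK.
  - have d0 := lt_le_trans e0 ed; split=> // -[S [cS bS hS]]; apply: bad.
    exists S; split=> // z; apply: le_trans (bS z) _.
    by rewrite ler_wpM2r ?nm_ge0 // lef_pV2.
  - apply: contrapT => h1; apply: h; exists e^-1; first by rewrite invr_gt0.
    move=> x Ex xx0; apply: contrapT => bad; apply: h1; exists x => //.
    by have := nm_revD x x0; lra.
  have Ey : E y.
    move/closed_nmP: cE; apply=> e /hy[x [_ [_ Ex _ _] yK]].
    by exists (K x) => //; apply: KE; exists x.
  have y0 : y != 0.
    apply/eqP => y0; have [x [_ [_ _ xx0 _]]] := hy 1 ltr01.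
    rewrite y0 sub0r nmN => Kx.
    have : nm (K x0) <= nm (K x) + k * nm (x - x0).
      have := nm_revD (K x0) (K x); have := Kk (x - x0).
      by rewrite linearB /= (nmC (K x)); lra.
    have : k * nm (x - x0) <= k by rewrite ger_pMr.
    lra.
  have [S cS xS] := dense y Ey y0 x0 2^-1 Ex0 ltac:(lra).
  have [bS _ _] := cS; have [c c0 Sc] := bounded_operatorP bS.
  have ec : 0 < (2 * c)^-1 by rewrite invr_gt0 mulr_gt0.
  have [x [_ [_ Ex xx0 bad] yK]] := hy _ ec; apply: bad; exists S; split=> //.
    move=> z; rewrite invrK; apply: le_trans (Sc z) _.
    by rewrite ler_wpM2r ?nm_ge0 //; lra.
  have := nm_dist (S (K x)) (S y) x0; rewrite -linearB (nmC (S y) x0).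
  have := Sc (K x - y); rewrite (nmC (K x)) => h1 h2.
  have : c * nm (y - K x) <= c * (2 * c)^-1 by rewrite ler_pM2l // ltW.
  have -> : c * (2 * c)^-1 = 2^-1 by rewrite invfM mulrCA divff ?mulr1 // gt_eqF.
  lra.
have chain n : exists S, [/\ commutant_on E K S, bounded_by (c ^+ n) S &
    nm (S (iter n K x0) - x0) <= 1].
  elim: n => [|n [W [cW bW hW]]].
    exists idfun; split; first exact: commutant_on_id.
      by move=> x; rewrite mul1r.
    by rewrite /= subrr nm0.
  have [_ WE WK] := cW.
  have En : E (iter n K x0) by apply: iter_invariant.
  have [|S [cS bS hS]] := hc (W (iter n K x0)) _ hW.
    by apply: WE; exists (iter n K x0).
  exists (S \o W); split; first exact: commutant_on_comp.
    move=> x /=; apply: le_trans (bS _) _.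
    by rewrite exprS -mulrA ler_pM2l //; exact: bW.
  by rewrite /= WK.
have [n n0 hn] := decay c (ltW c0).
have [S [_ bS hS]] := chain n.
have := hn x0; have := bS (iter n K x0); have := nm_revD x0 (S (iter n K x0)).
rewrite (nmC x0); lra.
Qed.

Lemma eigenspace_hyperinvariant E T y : closed_subspace E -> bounded_operator T ->
  E y -> eigenvector T y -> (forall a, exists2 x, E x & T x <> a *: x) ->
  exists2 L, nontrivial_in L E &
    forall S, commutant_on E T S -> invariant_under S L.
Proof.
move=> cE bT Ey [y0 [a Ty]] nonscalar.
pose L := E `&` (poly_op ('X - a%:P) T @^-1` [set 0]).
have LP x : L x <-> E x /\ T x = a *: x.
  rewrite /L /= poly_opXsubC; split=> -[Ex h]; split=> //.
    by apply/eqP; rewrite -subr_eq0; apply/eqP.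
  by rewrite h subrr.
exists L; first split.
- apply: closed_subspaceI => //; apply: closed_subspace_preimage.
    exact: poly_op_bounded.
  exact: closed_subspace0.
- by move=> x [].
- by exists y => //; apply/LP.
- by have [x Ex Tx] := nonscalar a; exists x => // /LP[].
move=> S [_ SE ST] _ [x /LP[Ex Tx] <-]; apply/LP; split; first by apply: SE; exists x.
by rewrite -ST // Tx linearZ.
Qed.

(** The commutant of [T] on [E] is contained in that of [K = q(T)].  An eigenvector
    of [K], or a vector killed by [K], satisfies a nontrivial polynomial equation
    in [T]: this is where the degree of [q] has to be positive, [q - a] being zero
    for a constant [q = a]. *)
Lemma polynomially_compact_hyperinvariant E T K (q : {poly R[i]}) : closed_subspace E ->
  bounded_operator T -> invariant_under T E -> (1 < size q)%N ->
  bounded_operator K -> compact_operator K -> (forall x, E (K x)) ->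
  (forall x, E x -> K x = poly_op q T x) ->
  (forall a, exists2 x, E x & T x <> a *: x) ->
  exists2 L, nontrivial_in L E &
    forall S, commutant_on E T S -> invariant_under S L.
Proof.
move=> cE bT TE q1 bK cK KE Kq nonscalar; have [sE _] := cE.
have from_kernel p x : p != 0 -> E x -> x != 0 -> poly_op p T x = 0 ->
    exists2 L, nontrivial_in L E &
      forall S, commutant_on E T S -> invariant_under S L.
  move=> p0 Ex x0 px.
  have [y Ey eigy] := annihilated_eigenvector sE TE Ex x0 p0 px.
  exact: eigenspace_hyperinvariant eigy nonscalar.
have [[a [x [a0 x0 Kx]]]|decay] := eigenvalue_or_power_decay bK cK.
  have Ex : E x.
    have -> : x = a^-1 *: K x by rewrite Kx scalerA mulVf // scale1r.
    exact: subspaceZ.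
  apply: (from_kernel (q - a%:P) x) => //.
    rewrite subr_eq0; apply: contraTneq q1 => ->.
    by rewrite -leqNgt size_polyC_leq1.
  by rewrite -polyCN poly_opD poly_opC -Kq // Kx scaleNr subrr.
have [[x Ex Kx]|K0] := pselect (exists2 x, E x & K x <> 0).
  have [||L ntL invL] := @decaying_compact_hyperinvariant E K x cE bK cK _ Ex _ decay.
  - by move=> _ [y _ <-].
  - exact/eqP.
  exists L => // S [bS SE ST]; apply: invL; split=> // y Ey.
  rewrite !Kq //; last by apply: SE; exists y.
  exact: poly_op_intertwine TE ST Ey.
have [x Ex Tx] := nonscalar 0.
have x0 : x != 0 by apply/eqP => x0; apply: Tx; rewrite x0 linear0 scaler0.
apply: (from_kernel q x) => //; first by rewrite -size_poly_gt0 ltnW.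
by rewrite -Kq //; apply: contrapT => Kx; apply: K0; exists x.
Qed.

End Hyperinvariant.

(** * Simultaneous triangularization *)

Section Gaps.
Variables (R : realType) (H : completeNormedModType R[i]).
Variables (dot : {dot H for Num.conj}) (H_hilbert : is_hilbert dot).
Implicit Types (S T A B : {linear H -> H}) (x y : H) (M N L : set H).

Lemma not_subset_ex M N : ~ N `<=` M -> exists2 x, N x & ~ M x.
Proof.
move=> h; apply: contrapT => h1; apply: h => x Nx.
by apply: contrapT => Mx; apply: h1; exists x.
Qed.

Definition strictly_between M L N :=
  [/\ closed_subspace L, M `<=` L, L `<=` N, ~ L `<=` M & ~ N `<=` L].

(** The compressions of [A] and [B] to the orthogonal complement [E] of [Mm] in
    [Mp] commute.  With [Q] the projection along [Mm], an invariant
    subspace [L] of the compressions [Q \o A], [Q \o B] in [E] lifts to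
    [Mp `&` Q @^-1` L].  The compression of [q(T)] is [q] of the compression of
    [T], so polynomial compactness is inherited; the factor ['X] added to the
    polynomial makes it nonconstant. *)
Lemma invariant_between_commuting A B Mm N Mp :
  bounded_operator A -> bounded_operator B ->
  polynomially_compact A -> polynomially_compact B ->
  closed_subspace Mm -> closed_subspace Mp -> strictly_between Mm N Mp ->
  invariant_under A Mm -> invariant_under B Mm ->
  invariant_under A Mp -> invariant_under B Mp ->
  (forall x, Mp x -> Mm (commutator A B x)) ->
  exists2 L, strictly_between Mm L Mp & invariant_under A L /\ invariant_under B L.
Proof.
move=> bA bB pA pB cMm cMp [cN MmN NMp /not_subset_ex[xN NxN MmxN]].
move=> /not_subset_ex[xp Mpxp Nxp] AMm BMm AMp BMp comm.
have [sMm _] := cMm; have [sMp _] := cMp; have [sN _] := cN.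
have [P [PM Pid PO bP]] := projection H_hilbert cMm.
have [Q QE bQ] : exists2 Q : {linear H -> H}, forall x, Q x = x - P x & bounded_operator Q.
  exists ((-1 \*: P) \+ idfun) => [x|]; first by rewrite /= scaleN1r addrC.
  apply: (@bounded_byW _ _ _ 2) => x; rewrite /= scaleN1r addrC.
  by rewrite (le_trans (nmB _ _)) //; have := bP x; lra.
have Q0 x : Mm x -> Q x = 0 by move=> Mx; rewrite QE Pid // subrr.
pose E := Mp `&` orth dot Mm.
have cE : closed_subspace E by apply: closed_subspaceI => //; exact: orth_closed_subspace.
have [sE _] := cE.
have QinE x : Mp x -> E (Q x).
  move=> Mx; rewrite QE; split; last exact: PO.
  by apply: subspaceB => //; apply: NMp; apply: MmN.
have Qid x : E x -> Q x = x.
  move=> [_ Ox]; rewrite QE; suff -> : P x = 0 by rewrite subr0.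
  apply: (dotxx_eq0 H_hilbert); have := PO x _ (PM x).
  by rewrite dotBl Ox // => /eqP; rewrite sub0r oppr_eq0 => /eqP.
have Qcomp T x : invariant_under T Mm -> Mp x -> Q (T x) = Q (T (Q x)).
  move=> TM Mx; apply/eqP; rewrite -subr_eq0 -!linearB; apply/eqP; apply: Q0.
  by apply: TM; exists (P x) => //; rewrite QE subKr.
have [PE [PEE PEid _ bPE]] := projection H_hilbert cE.
have E_invariant T : invariant_under T Mp -> invariant_under (Q \o T) E.
  by move=> TM _ [x [Mx _] <-]; apply: QinE; apply: TM; exists x.
have commE S T : invariant_under S Mm -> invariant_under S Mp ->
    invariant_under T Mm -> invariant_under T Mp -> bounded_operator S ->
    (forall x, Mp x -> Mm (S (T x) - T (S x))) ->
    commutant_on E (Q \o T) (Q \o S).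
  move=> SM SMp TM TMp bS ST; split; first exact: bounded_operator_comp.
    exact: E_invariant.
  move=> x [Mx _] /=; rewrite -Qcomp //; last by apply: TMp; exists x.
  rewrite -Qcomp //; last by apply: SMp; exists x.
  by apply/eqP; rewrite -subr_eq0 -linearB Q0 //; apply: ST.
have from_nonscalar T : bounded_operator T -> polynomially_compact T ->
    invariant_under T Mm -> invariant_under T Mp ->
    (forall a, exists2 x, E x & (Q \o T) x <> a *: x) ->
    exists2 L, nontrivial_in L E &
      forall S, commutant_on E (Q \o T) S -> invariant_under S L.
  move=> bT [p [p0 cp]] TM TMp; set Th : {linear H -> H} := Q \o T => nonscalar.
  pose K : {linear H -> H} := (Q \o T) \o poly_op p T \o PE.
  have bPE' : bounded_operator PE by exact: bounded_byW bPE.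
  apply: (@polynomially_compact_hyperinvariant _ _ _ H_hilbert E Th K (p * 'X)) => //.
  - exact: bounded_operator_comp.
  - exact: E_invariant.
  - by rewrite size_mulX // ltnS size_poly_gt0.
  - apply: bounded_operator_comp => //; apply: bounded_operator_comp.
      exact: bounded_operator_comp.
    exact: poly_op_bounded.
  - by apply: compact_operator_sandwich => //; exact: bounded_operator_comp.
  - move=> x; apply: QinE; apply: (TMp); exists (poly_op p T (PE x)) => //.
    by apply: (poly_op_invariant sMp TMp); exists (PE x) => //; case: (PEE x).
  - move=> x Ex; rewrite /K /= PEid // -poly_op_mulX -{2}(Qid _ Ex).
    apply: (poly_op_intertwine _ TMp); last by case: Ex.
    by move=> y My; exact: Qcomp.
have [L [cL LE [xL LxL xL0] [xE ExE LxE]] [AL BL]] : exists2 L, nontrivial_in L E &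
    invariant_under (Q \o A) L /\ invariant_under (Q \o B) L.
  have commAB : forall x, Mp x -> Mm (B (A x) - A (B x)).
    move=> x Mx; rewrite -opprB -scaleN1r; apply: subspaceZ => //; exact: comm.
  have commAA T x : Mm (T (T x) - T (T x)) by rewrite subrr; case: sMm.
  have [hA|hA] := pselect (forall a, exists2 x, E x & (Q \o A) x <> a *: x).
    have [L ntL inv] := from_nonscalar A bA pA AMm AMp hA.
    by exists L => //; split; apply: inv; apply: commE.
  have [hB|hB] := pselect (forall a, exists2 x, E x & (Q \o B) x <> a *: x).
    have [L ntL inv] := from_nonscalar B bB pB BMm BMp hB.
    by exists L => //; split; apply: inv; apply: commE.
  have scalar T : ~ (forall a, exists2 x, E x & (Q \o T) x <> a *: x) ->
      invariant_under (Q \o T) (E `&` N).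
    move=> /existsNP[a ha] _ [x [Ex Nx] <-].
    have -> : (Q \o T) x = a *: x by apply: contrapT => h; apply: ha; exists x.
    by split; apply: subspaceZ.
  exists (E `&` N); last by split; apply: scalar.
  split; first exact: closed_subspaceI.
  - by move=> x [].
  - exists (Q xN).
      split; first by apply: QinE; apply: NMp.
      by rewrite QE; apply: subspaceB => //; apply: MmN.
    by apply: contra_notN MmxN; rewrite QE subr_eq0 => /eqP ->.
  - exists (Q xp); first exact: QinE.
    move=> [_ h]; apply: Nxp; rewrite -(subrK (P xp) xp) -QE.
    by apply: subspaceD => //; apply: MmN.
exists (Mp `&` Q @^-1` L); first split.
- by apply: closed_subspaceI => //; apply: closed_subspace_preimage.
- move=> x Mx; split; first by apply: NMp; apply: MmN.
  by rewrite /= Q0 //; case: cL => -[].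
- by move=> x [].
- move=> h; have [Mx Ox] := LE _ LxL.
  have /Q0 : Mm xL by apply: h; split=> //=; rewrite Qid //; split.
  rewrite Qid; last by split.
  by apply/eqP.
- move=> h; have [Mx Ox] := ExE; have [_ /=] := h _ Mx.
  by rewrite Qid.
have lift T : invariant_under T Mm -> invariant_under T Mp ->
    invariant_under (Q \o T) L -> invariant_under T (Mp `&` Q @^-1` L).
  move=> TM TMp TL _ [x [Mx Lx] <-]; split; first by apply: TMp; exists x.
  by rewrite /preimage /= Qcomp //; apply: TL; exists (Q x).
by split; apply: lift.
Qed.

(** On ker [A], the commutator is [A B], so [A (A (B x)) = 0]. *)
Lemma kernel_invariant_of_left_annihilated A B x :
  normal_operator dot A -> (forall y, A (commutator A B y) = 0) ->
  A x = 0 -> A (B x) = 0.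
Proof.
move=> nA AC Ax; apply: (normal_ker2 H_hilbert nA).
by have := AC x; rewrite /commutator Ax linear0 subr0.
Qed.

(** Modulo [Mm], the kernel of [A] in [Mp] is jointly invariant.  If its closed
    span with [Mm] is [Mm], the commutator, which maps [Mp] into the part of ker [A]
    in [Mp], vanishes modulo [Mm]; if it is [Mp], then [A] itself vanishes modulo
    [Mm].  Normality of [A] enters the triangularization only through the
    invariance of ker [A]. *)
Lemma invariant_between A B Mm N Mp :
  bounded_operator A -> bounded_operator B ->
  polynomially_compact A -> polynomially_compact B ->
  normal_operator dot A -> (forall y, A (commutator A B y) = 0) ->
  closed_subspace Mm -> closed_subspace Mp -> strictly_between Mm N Mp ->
  invariant_under A Mm -> invariant_under B Mm ->
  invariant_under A Mp -> invariant_under B Mp ->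
  exists2 L, strictly_between Mm L Mp & invariant_under A L /\ invariant_under B L.
Proof.
move=> bA bB pA pB nA AC cMm cMp MmNMp AMm BMm AMp BMp.
have [cN MmN NMp _ _] := MmNMp; have [[sMm _] [sMp _]] := (cMm, cMp).
pose W := [set x + y | x in Mm & y in [set y | Mp y /\ A y = 0]].
have ker0 : Mp 0 /\ A 0 = 0 by rewrite linear0; split=> //; case: sMp.
have sW : subspace W.
  split; first by exists 0; [case: sMm|exists 0; rewrite ?addr0].
  move=> a _ _ [x1 Mx1 [y1 [My1 Ay1] <-]] [x2 Mx2 [y2 [My2 Ay2] <-]].
  exists (a *: x1 + x2); first exact: sMm.2.
  exists (a *: y1 + y2); last by rewrite scalerDr addrACA.
  by split; [exact: sMp.2|rewrite linearP Ay1 Ay2 scaler0 addr0].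
have MmW : Mm `<=` W.
  by move=> x Mx; exists x => //; exists 0; rewrite ?addr0.
have WMp : W `<=` Mp.
  by move=> _ [x Mx [y [My _] <-]]; apply: subspaceD => //; apply: NMp; apply: MmN.
have kerW y : Mp y -> A y = 0 -> W y.
  by move=> My Ay; exists 0; [case: sMm|exists y; rewrite ?add0r].
have AW : A @` W `<=` Mm.
  by move=> _ [_ [x Mx [y [_ Ay] <-]] <-]; rewrite linearD Ay addr0; apply: AMm; exists x.
have BW : invariant_under B W.
  move=> _ [_ [x Mx [y [My Ay] <-]] <-]; rewrite linearD; apply: subspaceD => //.
    by apply: MmW; apply: BMm; exists x.
  apply: kerW; first by apply: BMp; exists y.
  exact: kernel_invariant_of_left_annihilated.
have cW := subspace_closure sW.
have [_ clMp] := cMp.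
have clWMp : closure W `<=` Mp by rewrite [Mp](closure_id _).1 //; exact: closureS.
have finish := invariant_between_commuting bA bB pA pB cMm cMp MmNMp AMm BMm AMp BMp.
have [h1|h1] := pselect (closure W `<=` Mm).
  apply: finish => x Mx; apply: h1; apply: subset_closure; apply: kerW => //.
  by apply: subspaceB => //; [apply: AMp; exists (B x) => //; apply: BMp; exists x
                             |apply: BMp; exists (A x) => //; apply: AMp; exists x].
have [h2|h2] := pselect (Mp `<=` closure W).
  have [_ cpre] := closed_subspace_preimage bA cMm.
  have AclW : closure W `<=` A @^-1` Mm.
    rewrite [A @^-1` Mm](closure_id _).1 //.
    by apply: closureS => y Wy; apply: AW; exists y.
  apply: finish => x Mx; apply: subspaceB => //.
    by apply: AclW; apply: h2; apply: BMp; exists x.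
  by apply: BMm; exists (A x) => //; apply: AclW; apply: h2.
exists (closure W); first by split=> //; apply: subset_trans MmW _; exact: subset_closure.
split; apply: closure_invariant => //.
by move=> y /AW; apply: MmW.
Qed.

(** A maximal chain [C] of members of [I] contains every member of [I] that is
    comparable with all of [C].  A closed subspace [N] comparable with all of [C]
    but outside [C] therefore lies strictly between [Mm] and [Mp], and so would a
    member [L] of [I] given by the gap hypothesis; but [L], being itself in [C],
    would have to be below [Mm] or above [Mp]. *)
Lemma maximal_chain_of_no_gap (I : set (set H)) :
  I `<=` @closed_subspace R H ->
  (forall F, F `<=` I -> I (closed_span (\bigcup_(M in F) M))) ->
  (forall F, F `<=` I -> I (\bigcap_(M in F) M)) ->
  (forall Mm N Mp, I Mm -> I Mp -> strictly_between Mm N Mp ->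
     exists2 L, strictly_between Mm L Mp & I L) ->
  exists2 C, maximal_subspace_chain C & C `<=` I.
Proof.
move=> Isub Ispan Icap gap.
pose P (C : set (set H)) := C `<=` I /\ total_on C subset.
have [|C [[CI Ctot] Cmax]] := @Zorn_bigcup _ P.
  move=> F FP Ftot; split; first by move=> M [C /FP[CI _] /CI].
  move=> M N [C1 FC1 C1M] [C2 FC2 C2N].
  have [h|h] := Ftot _ _ FC1 FC2.
    by have [_] := FP _ FC2; apply=> //; exact: h.
  by have [_] := FP _ FC1; apply=> //; exact: h.
have Cin L : I L -> (forall M, C M -> M `<=` L \/ L `<=` M) -> C L.
  move=> IL Lcomp; apply: contrapT => CL.
  apply: (Cmax (C `|` [set L])); first split.
  - by move=> M CM; left.
  - by move=> h; apply: CL; apply: h; right.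
  split; first by move=> M [/CI//|->].
  move=> M N [CM|->] [CN|->]; [exact: Ctot|exact: Lcomp| |by left].
  by case: (Lcomp N CN); [right|left].
exists C => //; split; first by split=> // M /CI/Isub.
move=> D [Dsub Dtot] CD; apply/seteqP; split=> // N DN.
pose Mm := closed_span (\bigcup_(M in [set M | C M /\ M `<=` N]) M).
pose Mp := \bigcap_(M in [set M | C M /\ N `<=` M]) M.
have cN : closed_subspace N by apply: Dsub.
have compN M : C M -> M `<=` N \/ N `<=` M by move=> /CD DM; exact: Dtot.
have MmN : Mm `<=` N by apply: closed_span_min => // x [M [_ MN] /MN].
have NMp : N `<=` Mp by move=> x Nx M [_]; apply.
have subMm M : C M -> M `<=` N -> M `<=` Mm.
  by move=> CM MN x Mx; apply: sub_closed_span; exists M.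
have Mpsub M : C M -> N `<=` M -> Mp `<=` M by move=> CM NM x; apply.
have IMm : I Mm by apply: Ispan => M [/CI].
have IMp : I Mp by apply: Icap => M [/CI].
have CMm : C Mm.
  apply: Cin => // M CM; have [MN|NM] := compN M CM; first by left; apply: subMm.
  by right; apply: subset_trans NM.
have CMp : C Mp.
  apply: Cin => // M CM; have [MN|NM] := compN M CM; last by right; apply: Mpsub.
  by left; apply: subset_trans NMp.
have [h|NMm] := pselect (N `<=` Mm); first by have E : N = Mm; [apply/seteqP|rewrite E].
have [h|MpN] := pselect (Mp `<=` N); first by have E : N = Mp; [apply/seteqP|rewrite E].
have [L [cL MmL LMp LMm MpL] IL] : exists2 L, strictly_between Mm L Mp & I L.
  exact: (gap Mm N Mp).
have CL : C L.
  apply: Cin => // M CM; have [MN|NM] := compN M CM.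
    by left; apply: subset_trans MmL; apply: subMm.
  by right; apply: subset_trans LMp _; apply: Mpsub.
by case: (compN L CL) => [/(subMm _ CL)|/(Mpsub _ CL)].
Qed.

Lemma invariant_bigcup T (F : set (set H)) :
  (forall M, F M -> invariant_under T M) -> invariant_under T (\bigcup_(M in F) M).
Proof. by move=> h _ [x [M FM Mx] <-]; exists M => //; apply: (h M) => //; exists x. Qed.

Lemma invariant_bigcap T (F : set (set H)) :
  (forall M, F M -> invariant_under T M) -> invariant_under T (\bigcap_(M in F) M).
Proof. by move=> h _ [x Fx <-] M FM; apply: (h M) => //; exists x => //; apply: Fx. Qed.

Lemma triangularizable A B :
  bounded_operator A -> bounded_operator B ->
  polynomially_compact A -> polynomially_compact B ->
  normal_operator dot A -> (forall y, A (commutator A B y) = 0) ->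
  simultaneously_triangularizable A B.
Proof.
move=> bA bB pA pB nA AC.
pose I : set (set H) :=
  [set M | [/\ closed_subspace M, invariant_under A M & invariant_under B M]].
have [|F FI|F FI|Mm N Mp [cMm AMm BMm] [cMp AMp BMp] MNM|C maxC CI] :=
    @maximal_chain_of_no_gap I.
- by move=> M [].
- split; first exact: closed_span_subspace.
    by apply: closed_span_invariant => //; apply: invariant_bigcup => M /FI[].
  by apply: closed_span_invariant => //; apply: invariant_bigcup => M /FI[].
- split; first by apply: closed_subspace_bigcap => M /FI[].
    by apply: invariant_bigcap => M /FI[].
  by apply: invariant_bigcap => M /FI[].
- have [L MLM [AL BL]] := invariant_between bA bB pA pB nA AC cMm cMp MNM AMm BMm AMp BMp.
  by exists L => //; split=> //; case: MLM.
by exists C; split=> // M /CI[].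
Qed.

End Gaps.

(** * Simultaneous diagonalization *)

Section NormalPairs.
Variables (R : realType) (H : completeNormedModType R[i]).
Variables (dot : {dot H for Num.conj}) (H_hilbert : is_hilbert dot).
Implicit Types (S T A B : {linear H -> H}) (x y : H) (F : set H).

(** By log-convexity, the ratios of the norms of consecutive iterates do not
    decrease. *)
Lemma normal_power_growth T x n (q := nm (T x) / nm x) :
  normal_operator dot T -> T x != 0 -> q ^+ n * nm x <= nm (iter n T x).
Proof.
move=> nT Tx; have x0 : 0 < nm x.
  by rewrite nm_gt0; apply: contra_neq Tx => ->; rewrite linear0.
have q0 : 0 < q by rewrite divr_gt0 // nm_gt0.
have [] // : q ^+ n * nm x <= nm (iter n T x) /\
  (0 < nm (iter n T x) /\ q * nm (iter n T x) <= nm (iter n.+1 T x)).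
elim: n => [|n [IH [pos IHq]]]; first by rewrite mul1r /= divfK // gt_eqF.
have pos' : 0 < nm (iter n.+1 T x) by apply: lt_le_trans IHq; rewrite mulr_gt0.
split.
  by apply: le_trans IHq; rewrite exprS -mulrA ler_pM2l.
split=> //; rewrite -(ler_pM2r pos).
apply: le_trans (normal_log_convex H_hilbert _ nT).
rewrite expr2 mulrAC; apply: ler_pM => //; rewrite ?nm_ge0 //.
by rewrite mulr_ge0 // ltW.
Qed.

(** The adjoint of [T] is not assumed to preserve [F]: the growth estimate is
    applied to [q(T)], normal on the whole space, at a vector of [F], and contradicts decay of the powers of [q(T)] composed with the
    projection onto [F]. *)
Lemma normal_eigenvector T F x : bounded_operator T -> polynomially_compact T ->
  normal_operator dot T -> closed_subspace F -> invariant_under T F ->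
  F x -> x != 0 -> exists2 y, F y & eigenvector T y.
Proof.
move=> bT [p [p0 cp]] nT cF TF Fx x0; have [sF _] := cF.
pose q := p * 'X; have q1 : (1 < size q)%N by rewrite size_mulX // ltnS size_poly_gt0.
have q0 : q != 0 by rewrite -size_poly_gt0 ltnW.
have [qx|qx] := eqVneq (poly_op q T x) 0; first exact: annihilated_eigenvector qx.
have [P [PF Pid _ bP]] := projection H_hilbert cF.
have bP' : bounded_operator P by exact: bounded_byW bP.
pose K : {linear H -> H} := T \o poly_op p T \o P.
have KE y : F y -> K y = poly_op q T y by move=> Fy; rewrite poly_op_mulX /K /= Pid.
have qF := poly_op_invariant (p := q) sF TF.
have KF y : F (K y).
  by rewrite /K /= -poly_op_mulX; apply: qF; exists (P y).
have bK : bounded_operator K.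
  by do 2?[apply: bounded_operator_comp => //]; exact: poly_op_bounded.
have cK : compact_operator K by exact: compact_operator_sandwich.
have [[a [y [a0 y0 Ky]]]|decay] := eigenvalue_or_power_decay H_hilbert bK cK.
  have Fy : F y.
    have -> : y = a^-1 *: K y by rewrite Ky scalerA mulVf // scale1r.
    exact: subspaceZ.
  apply: (@annihilated_eigenvector _ _ (q - a%:P) T F y) => //.
    rewrite subr_eq0; apply: contraTneq q1 => ->.
    by rewrite -leqNgt size_polyC_leq1.
  by rewrite -polyCN poly_opD poly_opC -KE // Ky scaleNr subrr.
have xp : 0 < nm x by rewrite nm_gt0.
pose s := nm (poly_op q T x) / nm x.
have s0 : 0 < s by rewrite divr_gt0 // nm_gt0.
have si0 : 0 <= s^-1 by rewrite invr_ge0 ltW.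
have [n _ /(_ x)] := decay s^-1 si0.
have -> : iter n K x = iter n (poly_op q T) x.
  by elim: n => // n IH; rewrite !iterS IH KE //; apply: iter_invariant.
have := normal_power_growth n (poly_op_normal q nT) qx; rewrite -/s => h1 h2.
have : s^-1 ^+ n * (s ^+ n * nm x) <= 3 / 4 * nm x.
  by apply: le_trans h2; rewrite ler_wpM2l // exprn_ge0 // invr_ge0 ltW.
by rewrite mulrA -exprMn mulVf ?gt_eqF // expr1n; lra.
Qed.

Lemma common_eigenvector A B F x :
  bounded_operator A -> bounded_operator B ->
  polynomially_compact A -> polynomially_compact B ->
  normal_operator dot A -> normal_operator dot B ->
  (forall y, A (commutator A B y) = 0) ->
  closed_subspace F -> invariant_under A F -> invariant_under B F ->
  F x -> x != 0 -> exists2 y, F y & eigenvector A y /\ eigenvector B y.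
Proof.
move=> bA bB pA pB nA nB AC cF AF BF Fx x0; have [sF _] := cF.
have [a [y Fy [y0 Ay]] inv] : exists2 a, exists2 y, F y & y != 0 /\ A y = a *: y &
    forall z, F z -> A z = a *: z -> A (B z) = a *: B z.
  have [[y [Fy y0 Ay]]|inj] := pselect (exists y, [/\ F y, y != 0 & A y = 0]).
    exists 0; first by exists y; rewrite ?scale0r.
    move=> z _; rewrite !scale0r.
    exact: kernel_invariant_of_left_annihilated.
  have [y Fy [y0 [a Ay]]] := normal_eigenvector bA pA nA cF AF Fx x0.
  exists a; first by exists y.
  move=> z Fz Az; apply/eqP; rewrite -linearZ -Az -subr_eq0 -/(commutator A B z).
  apply/eqP; apply: contrapT => /eqP cz; apply: inj; exists (commutator A B z).
  split=> //; apply: subspaceB => //.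
    by apply: AF; exists (B z) => //; apply: BF; exists z.
  by apply: BF; exists (A z) => //; apply: AF; exists z.
pose G := F `&` (poly_op ('X - a%:P) A @^-1` [set 0]).
have GP z : G z <-> F z /\ A z = a *: z.
  rewrite /G /= poly_opXsubC; split=> -[Fz h]; split=> //.
    by apply/eqP; rewrite -subr_eq0; apply/eqP.
  by rewrite h subrr.
have cG : closed_subspace G.
  apply: closed_subspaceI => //; apply: closed_subspace_preimage.
    exact: poly_op_bounded.
  exact: closed_subspace0.
have BG : invariant_under B G.
  move=> _ [z /GP[Fz Az] <-]; apply/GP; split; first by apply: BF; exists z.
  exact: inv.
have Gy : G y by apply/GP.
have [z /GP[Fz Az] [z0 Bz]] := normal_eigenvector bB pB nB cG BG Gy y0.
by exists z => //; split; split=> //; exists a.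
Qed.

Lemma diagonalizable_of_left_annihilated A B :
  bounded_operator A -> bounded_operator B ->
  polynomially_compact A -> polynomially_compact B ->
  normal_operator dot A -> normal_operator dot B ->
  (forall y, A (commutator A B y) = 0) ->
  simultaneously_diagonalizable A B.
Proof.
move=> bA bB pA pB nA nB AC; apply/eqP; apply: contrapT => /negP.
set X := [set x | _] => /(orth_neq0 H_hilbert (closed_span_subspace X))[x x0 Ox].
have OXx : orth dot X x by move=> y Xy; apply: Ox; exact: sub_closed_span.
have inv T : normal_operator dot T -> (forall y, X y -> eigenvector T y) ->
    invariant_under T (orth dot X).
  move=> nT eT _ [y Oy <-] z Xz; have [_ [a Tz]] := eT z Xz.
  by apply: (normal_orth_eigen H_hilbert nT Tz); exact: Oy.
have [||y Oy eig] := common_eigenvector bA bB pA pB nA nB AC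
    (orth_closed_subspace H_hilbert X) _ _ OXx x0.
- by apply: inv => // y [].
- by apply: inv => // y [].
have [[y0 _] _] := eig; move/eqP: y0; apply; apply: (dotxx_eq0 H_hilbert).
exact: Oy.
Qed.

Lemma diagonalizable_commute A B :
  bounded_operator A -> bounded_operator B ->
  simultaneously_diagonalizable A B -> forall x, commutator A B x = 0.
Proof.
move=> bA bB diag x.
pose C : {linear H -> H} := (-1 \*: (B \o A)) \+ (A \o B).
have CE y : C y = commutator A B y by rewrite /= scaleN1r addrC.
have bC : bounded_operator C.
  have [c _ hc] := bounded_operatorP (bounded_operator_comp bB bA).
  have [d _ hd] := bounded_operatorP (bounded_operator_comp bA bB).
  apply: (@bounded_byW _ _ _ (c + d)) => y; rewrite CE /commutator.
  by rewrite (le_trans (nmB _ _)) // mulrDl addrC lerD //; [exact: hc|exact: hd].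
have cker := closed_subspace_preimage bC (@closed_subspace0 R H).
have ker : [set y | eigenvector A y /\ eigenvector B y] `<=` C @^-1` [set 0].
  move=> y [[_ [a Ay]] [_ [b By]]]; rewrite /preimage /= scaleN1r Ay By !linearZ /=.
  by rewrite Ay By !scalerN !scalerA mulrC addNr.
rewrite -CE; apply: (closed_span_min cker ker).
by move: diag; rewrite /simultaneously_diagonalizable => ->.
Qed.

End NormalPairs.

Theorem theorem4p4 (R : realType) (H : completeNormedModType R[i])
    (dot : {dot H for Num.conj}) (H_hilbert : is_hilbert dot)
    (A B : {linear H -> H})
    (A_bounded : bounded_operator A) (B_bounded : bounded_operator B)
    (A_polycompact : polynomially_compact A)
    (B_polycompact : polynomially_compact B)
    (A_normal : normal_operator dot A)
    (A_comm : forall x, A (commutator A B x) = 0) :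
  (simultaneously_triangularizable A B /\
   forall x, commutator A B (commutator A B x) = 0) /\
  (normal_operator dot B ->
   simultaneously_diagonalizable A B /\ forall x, commutator A B x = 0).
Proof.
split; first split.
- exact: (triangularizable H_hilbert).
- move=> x; rewrite {1}/commutator A_comm linear0 subr0.
  exact: (kernel_invariant_of_left_annihilated H_hilbert).
move=> B_normal.
have diag : simultaneously_diagonalizable A B.
  exact: (diagonalizable_of_left_annihilated H_hilbert).
by split=> //; exact: diagonalizable_commute.
Qed.
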